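(* Let $\Gamma$ be an oriented Jordan smooth curve, $\alpha$ a diffeomorphism of $\Gamma$ onto itself with a nonempty set of periodic points, $X(\Gamma)$ a reflexive rearrangement-invariant space of fundamental type with nontrivial Boyd indices, and $a,b\in C(\Gamma)$. Then $A=aI-bW$ is right invertible in $X(\Gamma)$ if and only if the operator $A_m:=a_mI-b_m(\alpha_{m-1})W^m$ is right invertible in $X(\Gamma)$ and $|a_i(t)|+|b[\alpha_{i-1}(t)]|>0$ for all $t\in\Gamma_4$ and all $i=1,2,\dots,m-1$.
   Context: R.-i. space with Boyd indices $\alpha_X,\beta_X$ and Zippin indices $p_X,q_X$ (standard definitions); nontrivial means $0<\alpha_X\le\beta_X<1$, fundamental type means $\alpha_X=p_X$, $\beta_X=q_X$. $\alpha_n$ are the iterates of $\alpha$, $Wf=f\circ\alpha$, $f(\alpha_k)=f\circ\alpha_k$. $m$ is the common multiplicity of periodic points if $\alpha$ preserves orientation, $m=2$ if $\alpha$ changes orientation; $\Phi=\overline{\{t:\alpha_m(t)\neq t\}}$. $f_k(t)=\prod_{i=0}^{k-1}f[\alpha_i(t)]$. $\eta_0(t)=|a_m(t)|-|b_m(t)|\min\{|\alpha_m'(t)|^{-\alpha_X},|\alpha_m'(t)|^{-\beta_X}\}$, $\eta_1(t)=|a_m(t)|-|b_m(t)|\max\{|\alpha_m'(t)|^{-\alpha_X},|\alpha_m'(t)|^{-\beta_X}\}$, $\eta_i^\pm(t)=\lim_{n\to\pm\infty}\eta_i[\alpha_{mn}(t)]$, and $\Gamma_4=\{t\in\Phi:\eta_0^+(t)<0<\eta_1^-(t)\}$.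 *)

(* Defs.v *)
From HB Require Import structures.
From mathcomp Require Import all_boot all_order all_algebra.
From mathcomp Require Import complex.
From mathcomp Require Import all_classical all_reals all_analysis.
Set Implicit Arguments.
Unset Strict Implicit.
Unset Printing Implicit Defensive.
Import Order.TTheory GRing.Theory Num.Theory.
Import numFieldNormedType.Exports.
Local Open Scope classical_set_scope.
Local Open Scope ring_scope.

Section Defs.
Variable R : realType.
Local Notation C := (R[i]).
Local Notation normc := (@ComplexField.Normc.normc R).

(* The curve.  Gamma = gamma(R) where gamma : R -> C is the arc-length  *)
(* parametrization (in the direction of the orientation), of period L. *)

Definition rderiv (g : R -> C) (s : R) (v : C) : Prop :=
  forall e : R, 0 < e -> exists2 d : R, 0 < d & forall h : R,
    0 < `|h| < d -> normc ((g (s + h) - g s) / (h%:C)%C - v) < e.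

Definition rcont (g : R -> C) : Prop :=
  forall s e : R, 0 < e -> exists2 d : R, 0 < d & forall s' : R,
    `|s' - s| < d -> normc (g s' - g s) < e.

Definition smooth_jordan_curve (L : R) (gamma : R -> C) : Prop :=
  [/\ 0 < L,
      (forall s, gamma (s + L) = gamma s),
      (forall s t, 0 <= s < L -> 0 <= t < L -> gamma s = gamma t -> s = t)
    & exists2 g' : R -> C, (forall s, rderiv gamma s (g' s)) /\ rcont g'
                          & forall s, normc (g' s) = 1].

Definition curve (gamma : R -> C) : set C := range gamma.

Definition cont_on (G : set C) (f : C -> C) : Prop :=
  forall t, G t -> forall e : R, 0 < e -> exists2 d : R, 0 < d &
    forall tau, G tau -> normc (tau - t) < d -> normc (f tau - f t) < e.

Definition deriv_along (G : set C) (f : C -> C) (t d : C) : Prop :=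
  forall e : R, 0 < e -> exists2 del : R, 0 < del &
    forall tau, G tau -> 0 < normc (tau - t) < del ->
      normc ((f tau - f t) / (tau - t) - d) < e.

Definition C1_on (G : set C) (f : C -> C) : Prop :=
  (forall t, G t -> G (f t)) /\
  exists2 f' : C -> C, (forall t, G t -> deriv_along G f t (f' t)) & cont_on G f'.

Definition diffeo_on (G : set C) (al : C -> C) : Prop :=
  exists2 be : C -> C, C1_on G al /\ C1_on G be &
    (forall t, G t -> be (al t) = t) /\ (forall t, G t -> al (be t) = t).

Definition inv_on (G : set C) (al : C -> C) (z : C) : C :=
  xget z [set w | G w /\ al w = z].

Definition iter_int (G : set C) (al : C -> C) (n : int) : C -> C :=
  match n with
  | Posz k => iter k al
  | Negz k => iter k.+1 (inv_on G al)
  end.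

Definition has_periodic_point (G : set C) (al : C -> C) : Prop :=
  exists2 t, G t & exists2 k : nat, (0 < k)%N & iter k al t = t.

Definition preserves_orientation (gamma : R -> C) (al : C -> C) : Prop :=
  exists h : R -> R, continuous h /\ (forall s t, s < t -> h s < h t) /\
                     (forall s, al (gamma s) = gamma (h s)).

(* m : common multiplicity (least period) of periodic points if alpha
   preserves orientation, m = 2 if alpha changes orientation *)
Definition least_period (G : set C) (al : C -> C) : nat :=
  xget 0%N [set k : nat | [/\ (0 < k)%N,
      (exists2 t, G t & iter k al t = t)
    & forall j : nat, (0 < j < k)%N -> ~ exists2 t, G t & iter j al t = t]].

Definition mult (gamma : R -> C) (al : C -> C) : nat :=
  if `[< preserves_orientation gamma al >] then least_period (curve gamma) al
  else 2%N.

Definition Phi (gamma : R -> C) (al : C -> C) : set C :=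
  [set t | curve gamma t /\ forall e : R, 0 < e ->
     exists2 tau, curve gamma tau /\ iter (mult gamma al) al tau != tau
                  & normc (tau - t) < e].

Definition iprod (al : C -> C) (f : C -> C) (k : nat) (t : C) : C :=
  \prod_(i < k) f (iter i al t).

Definition abs_deriv (G : set C) (f : C -> C) (t : C) : R :=
  normc (xget 0 [set d | deriv_along G f t d]).

(* Measure on Gamma (arc length) through the parametrization.          *)

Definition period_set (L : R) : set R := [set s | 0 <= s < L].

Definition meas_on (L : R) (gamma : R -> C) (f : C -> R) : Prop :=
  measurable_fun (period_set L) (f \o gamma).

Definition measC_on (L : R) (gamma : R -> C) (f : C -> C) : Prop :=
  meas_on L gamma (fun z => complex.Re (f z)) /\ meas_on L gamma (fun z => complex.Im (f z)).

Definition meas_set_on (L : R) (gamma : R -> C) (E : set C) : Prop :=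
  measurable (period_set L `&` (gamma @^-1` E)).

Definition ae_on (L : R) (gamma : R -> C) (P : C -> Prop) : Prop :=
  (@lebesgue_measure R).-negligible [set s | period_set L s /\ ~ P (gamma s)].

Definition nonneg (f : C -> R) : Prop := forall z, 0 <= f z.

(* Banach function norms (Bennett-Sharpley, Def. I.1.1) on Gamma.       *)

Definition mfun_on L gamma f := meas_on L gamma f /\ nonneg f.

Definition banach_function_norm (L : R) (gamma : R -> C)
  (rho : (C -> R) -> \bar R) : Prop :=
  (forall f, mfun_on L gamma f -> (0 <= rho f)%E) /\
  (forall f, mfun_on L gamma f -> (rho f = 0%E <-> ae_on L gamma (fun z => f z = 0))) /\
  (forall f c, mfun_on L gamma f -> 0 <= c ->
      rho (fun z => c * f z) = (c%:E * rho f)%E) /\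
  (forall f g, mfun_on L gamma f -> mfun_on L gamma g ->
      (rho (fun z => (f z + g z)%R) <= rho f + rho g)%E) /\
  (forall f g, mfun_on L gamma f -> mfun_on L gamma g ->
      ae_on L gamma (fun z => g z <= f z) -> (rho g <= rho f)%E) /\
  (forall (fn : nat -> C -> R) f, (forall n, mfun_on L gamma (fn n)) ->
      mfun_on L gamma f ->
      ae_on L gamma (fun z => (forall n, fn n z <= fn n.+1 z) /\
                              (fun n => fn n z) @ \oo --> f z) ->
      (fun n => rho (fn n)) @ \oo --> rho f) /\
  (forall E, meas_set_on L gamma E -> (rho (\1_E) < +oo)%E) /\
  (forall E, meas_set_on L gamma E -> exists CE : R,
     forall f, mfun_on L gamma f ->
       (\int[@lebesgue_measure R]_(s in period_set L `&` (gamma @^-1` E)) (f (gamma s))%:E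
          <= CE%:E * rho f)%E).

Definition distribution (L : R) (gamma : R -> C) (f : C -> R) (y : R) : \bar R :=
  (@lebesgue_measure R) (period_set L `&` [set s | y < f (gamma s)]).

Definition rearrangement_invariant (L : R) (gamma : R -> C)
  (rho : (C -> R) -> \bar R) : Prop :=
  forall f g, mfun_on L gamma f -> mfun_on L gamma g ->
    (forall y, 0 <= y -> distribution L gamma f y = distribution L gamma g y) ->
    rho f = rho g.

Definition normX (rho : (C -> R) -> \bar R) (f : C -> C) : R :=
  fine (rho (fun z => normc (f z))).

Definition inX (L : R) (gamma : R -> C) (rho : (C -> R) -> \bar R)
  (f : C -> C) : Prop :=
  measC_on L gamma f /\ (rho (fun z => normc (f z)) < +oo)%E.

Definition in_dual L gamma rho (phi : (C -> C) -> C) : Prop :=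
  [/\ (forall f g, inX L gamma rho f -> inX L gamma rho g ->
         phi (fun z => f z + g z) = phi f + phi g),
      (forall (c : C) f, inX L gamma rho f -> phi (fun z => c * f z) = c * phi f)
    & exists K : R, forall f, inX L gamma rho f -> normc (phi f) <= K * normX rho f].

Definition in_bidual L gamma rho (Ph : ((C -> C) -> C) -> C) : Prop :=
  [/\ (forall p q, in_dual L gamma rho p -> in_dual L gamma rho q ->
         Ph (fun f => p f + q f) = Ph p + Ph q),
      (forall (c : C) p, in_dual L gamma rho p -> Ph (fun f => c * p f) = c * Ph p)
    & exists K : R, forall p, in_dual L gamma rho p ->
        forall M : R, 0 <= M ->
          (forall f, inX L gamma rho f -> normc (p f) <= M * normX rho f) ->
          normc (Ph p) <= K * M].

Definition reflexive_space L gamma rho : Prop :=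
  forall Ph, in_bidual L gamma rho Ph ->
    exists2 f, inX L gamma rho f & forall p, in_dual L gamma rho p -> Ph p = p f.

(* Boyd and Zippin indices, via the Luxemburg representation on (0,L). *)

Definition coord (L : R) (gamma : R -> C) (z : C) : R :=
  xget 0 [set s | period_set L s /\ gamma s = z].

Definition rho_bar L gamma (rho : (C -> R) -> \bar R) (g : R -> R) : \bar R :=
  rho (fun z => g (coord L gamma z)).

Definition dilation (L t : R) (g : R -> R) (s : R) : R :=
  if s * t < L then g (s * t) else 0.

Definition boyd_h L gamma rho (t : R) : \bar R :=
  ereal_sup [set rho_bar L gamma rho (dilation L t^-1 g) | g in
     [set g : R -> R | [/\ measurable_fun (period_set L) g, (forall s, 0 <= g s)
                         & (rho_bar L gamma rho g <= 1)%E]]].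

Definition boyd_lower L gamma rho : R :=
  lim ((fun t => ln (fine (boyd_h L gamma rho t)) / ln t) x @[x --> 0^'+]).
Definition boyd_upper L gamma rho : R :=
  lim ((fun t => ln (fine (boyd_h L gamma rho t)) / ln t) x @[x --> +oo]).

Definition fundamental_fun L gamma rho (t : R) : R :=
  fine (rho_bar L gamma rho (\1_[set s | 0 <= s < t])).

Definition zippin_M L gamma rho (t : R) : \bar R :=
  ereal_sup [set (fundamental_fun L gamma rho (s * t) / fundamental_fun L gamma rho s)%:E
     | s in [set s : R | 0 < s < L /\ 0 < s * t < L]].

Definition zippin_lower L gamma rho : R :=
  lim ((fun t => ln (fine (zippin_M L gamma rho t)) / ln t) x @[x --> 0^'+]).
Definition zippin_upper L gamma rho : R :=
  lim ((fun t => ln (fine (zippin_M L gamma rho t)) / ln t) x @[x --> +oo]).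

Definition nontrivial_indices L gamma rho : Prop :=
  0 < boyd_lower L gamma rho /\ boyd_lower L gamma rho <= boyd_upper L gamma rho /\
  boyd_upper L gamma rho < 1.

Definition fundamental_type L gamma rho : Prop :=
  boyd_lower L gamma rho = zippin_lower L gamma rho /\
  boyd_upper L gamma rho = zippin_upper L gamma rho.

Definition bounded_linear_op L gamma rho (T : (C -> C) -> (C -> C)) : Prop :=
  [/\ (forall f, inX L gamma rho f -> inX L gamma rho (T f)),
      (forall f g, inX L gamma rho f -> inX L gamma rho g ->
         ae_on L gamma (fun z => T (fun w => f w + g w) z = T f z + T g z)),
      (forall (c : C) f, inX L gamma rho f ->
         ae_on L gamma (fun z => T (fun w => c * f w) z = c * T f z))
    & exists K : R, forall f, inX L gamma rho f -> normX rho (T f) <= K * normX rho f].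

Definition right_invertible L gamma rho (T : (C -> C) -> (C -> C)) : Prop :=
  exists2 Rop, bounded_linear_op L gamma rho Rop &
    forall f, inX L gamma rho f -> ae_on L gamma (fun z => T (Rop f) z = f z).

(* A = aI - bW,  W f = f o alpha *)
Definition opA (a b : C -> C) (al : C -> C) (f : C -> C) : C -> C :=
  fun z => a z * f z - b z * f (al z).

Definition opAm (m : nat) (a b : C -> C) (al : C -> C) (f : C -> C) : C -> C :=
  fun z => iprod al a m z * f z
           - iprod al b m (iter m.-1 al z) * f (iter m al z).

Definition eta0 L gamma rho (al a b : C -> C) (t : C) : R :=
  let m := mult gamma al in
  let d := abs_deriv (curve gamma) (iter m al) t in
  normc (iprod al a m t) - normc (iprod al b m t) *
    Num.min (d `^ (- boyd_lower L gamma rho)) (d `^ (- boyd_upper L gamma rho)).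

Definition eta1 L gamma rho (al a b : C -> C) (t : C) : R :=
  let m := mult gamma al in
  let d := abs_deriv (curve gamma) (iter m al) t in
  normc (iprod al a m t) - normc (iprod al b m t) *
    Num.max (d `^ (- boyd_lower L gamma rho)) (d `^ (- boyd_upper L gamma rho)).

Definition Gamma4 L gamma rho (al a b : C -> C) : set C :=
  [set t | Phi gamma al t /\
     exists l0 l1 : R,
       [/\ (fun n : nat => eta0 L gamma rho al a b
               (iter_int (curve gamma) al ((mult gamma al * n)%N%:Z) t)) @ \oo --> l0,
           (fun n : nat => eta1 L gamma rho al a b
               (iter_int (curve gamma) al (- ((mult gamma al * n)%N%:Z)) t)) @ \oo --> l1,
           l0 < 0 & 0 < l1]].

End Defs.

(* Main.v *)
Require Import Defs.
From HB Require Import structures.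
From mathcomp Require Import all_boot all_order all_algebra.
From mathcomp Require Import complex.
From mathcomp Require Import all_classical all_reals all_analysis.
From mathcomp Require Import measurable_realfun ring lra.
Import Order.TTheory GRing.Theory Num.Theory.
Import numFieldNormedType.Exports.
Local Open Scope classical_set_scope.
Local Open Scope ring_scope.

(* Put W f = f o alpha.  Composition with the bi-Lipschitz map alpha multiplies
   distribution functions by a bounded factor, so it is dominated by a dilation
   of the decreasing rearrangement, and a positive upper Boyd index makes some
   large dilation bounded: W is invertible in X.

   If aI - bW is right invertible, then |a| + |b| > 0 on Gamma (test on small
   arcs); a Bezout relation ac + bd = 1 then turns a right inverse of aI - bW
   into one of aI - (b o alpha)W.  Hence all aI - (b o alpha_j)W are right
   invertible, which gives |a_i| + |b o alpha_(i-1)| > 0 everywhere.  Moreover,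
   for w^m = 1 there is a unimodular u with w (u o alpha) = u almost everywhere,
   and conjugation by u replaces b by wb.  Finally, if the w_j are the m-th roots
   of unity, then with a_j' = a o alpha_(m-1-j) and b' = b o alpha_(m-1)
     A_m = (a_0' I - w_0 b' W) ... (a_(m-1)' I - w_(m-1) b' W),
   where every factor is conjugate by a power of W to some
   aI - w_j (b o alpha_j)W; this gives one direction, and the first factor with
   w_0 = 1, which is conjugate to aI - bW, gives the other. *)

(** If the coefficients commuted with W, the identity X^m - Y^m = prod (X - w_j Y) would settle the
    matter. They do not, and the obstacle is to make all mixed terms of the product agree. Lowering
    the shift of a by one per factor, with b at the fixed shift m-1, achieves this: in every term
    the argument of a coefficient depends only on how many coefficients of the same kind stand to
    its left. The price is that the j-th factor carries the shifts m-1-j and m-1, which no single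
    conjugation brings back to 0; the Bezout step bridges this gap of j. The gauge u comes from the
    dynamics. If alpha preserves orientation, a periodic orbit cuts Gamma into m arcs that alpha
    permutes cyclically, and u is a power of w^-1 on each arc. If alpha changes orientation, then w
    is 1 or -1, and u is w to the number of whole periods in the displacement of a lift of alpha,
    whose parity alpha flips off the fixed points. Such a u is in general discontinuous, hence only
    measurability is asked of it. *)

(** * The modulus of complex numbers *)

Section ComplexModulus.
Context {R : realType}.
Local Notation nc := (@ComplexField.Normc.normc R).
Implicit Types x y z : R[i].

Lemma nc_ge0 z : 0 <= nc z.
Proof. by case: z => a b /=; rewrite sqrtr_ge0. Qed.

Lemma nc0 : nc 0 = 0.
Proof. exact: ComplexField.Normc.normc0. Qed.

Lemma nc1 : nc 1 = 1.
Proof. exact: ComplexField.Normc.normc1. Qed.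

Lemma ncM x y : nc (x * y) = nc x * nc y.
Proof. exact: ComplexField.Normc.normcM. Qed.

Lemma ncN x : nc (- x) = nc x.
Proof. exact: normcN. Qed.

Lemma ncD x y : nc (x + y) <= nc x + nc y.
Proof. exact: le_normcD. Qed.

Lemma ncB x y : nc (x - y) <= nc x + nc y.
Proof. by rewrite -(ncN y) ncD. Qed.

Lemma ncC x y : nc (x - y) = nc (y - x).
Proof. by rewrite -ncN opprB. Qed.

Lemma ncV x : nc x^-1 = (nc x)^-1.
Proof. exact: ComplexField.Normc.normcV. Qed.

Lemma ncX x n : nc (x ^+ n) = nc x ^+ n.
Proof. by elim: n => [|n IH]; rewrite ?expr0 ?nc1// !exprS ncM IH. Qed.

Lemma nc_eq0 z : (nc z == 0) = (z == 0).
Proof.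
apply/eqP/eqP => [|->]; [exact: ComplexField.Normc.eq0_normc|exact: nc0].
Qed.

Lemma nc_gt0 z : (0 < nc z) = (z != 0).
Proof. by rewrite lt0r nc_eq0 nc_ge0 andbT. Qed.

Lemma nc_real (r : R) : nc (r%:C)%C = `|r|.
Proof. by rewrite /= expr0n/= addr0 sqrtr_sqr. Qed.

Lemma nc_conj z : nc (z^*)%C = nc z.
Proof. by case: z => a b /=; rewrite sqrrN. Qed.

Lemma mulc_conj z : z * (z^*)%C = ((nc z ^+ 2)%:C)%C.
Proof.
case: z => a b; apply/eqP; rewrite eq_complex /= sqr_sqrtr ?addr_ge0 ?sqr_ge0//.
by apply/andP; split; apply/eqP; ring.
Qed.

Lemma Re_le_nc z : `|complex.Re z| <= nc z.
Proof.
by case: z => a b /=; rewrite -sqrtr_sqr ler_wsqrtr// lerDl sqr_ge0.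
Qed.

Lemma Im_le_nc z : `|complex.Im z| <= nc z.
Proof.
by case: z => a b /=; rewrite -sqrtr_sqr ler_wsqrtr// lerDr sqr_ge0.
Qed.

Lemma root_of_unity_nc z m : (0 < m)%N -> z ^+ m = 1 -> nc z = 1.
Proof.
move=> m0 /(congr1 nc); rewrite ncX nc1 => /eqP.
by rewrite -[X in _ == X](expr1n _ m) eqrXn2 ?nc_ge0// => /eqP.
Qed.

End ComplexModulus.

(** * The space X and its bounded operators, up to almost everywhere equality *)

Section FunctionSpace.
Context {R : realType} {L : R} {gamma : R -> R[i]}.
Context {rho : (R[i] -> R) -> \bar R}.
Local Notation nc := (@ComplexField.Normc.normc R).
Implicit Types (f g c : R[i] -> R[i]) (T S : (R[i] -> R[i]) -> R[i] -> R[i]).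

Lemma measurable_period_set : measurable (period_set L).
Proof.
rewrite (_ : period_set L = `[0, L[%classic); first exact: measurable_itv.
by apply/seteqP; split=> s /=; rewrite in_itv.
Qed.
Local Hint Resolve measurable_period_set : core.

Lemma ae_on_imp (P Q : R[i] -> Prop) :
  (forall s, period_set L s -> P (gamma s) -> Q (gamma s)) ->
  ae_on L gamma P -> ae_on L gamma Q.
Proof.
move=> PQ; apply: negligibleS => s [Ls nQ]; split => // Ps.
exact/nQ/PQ.
Qed.

Lemma ae_on_all (P : R[i] -> Prop) :
  (forall s, period_set L s -> P (gamma s)) -> ae_on L gamma P.
Proof.
move=> H; rewrite /ae_on (_ : [set _ | _] = set0); first exact: negligible_set0.
by apply/seteqP; split => // s [Ls]; case; exact: H.
Qed.

Lemma ae_on_and (P Q : R[i] -> Prop) : ae_on L gamma P -> ae_on L gamma Q ->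
  ae_on L gamma (fun z => P z /\ Q z).
Proof.
move=> hP hQ; apply: negligibleS (negligibleU hP hQ) => s [Ls nPQ].
have [Ps|] := pselect (P (gamma s)); last by left.
by right; split => // Qs; apply: nPQ.
Qed.

Lemma measC_onD f g : measC_on L gamma f -> measC_on L gamma g ->
  measC_on L gamma (fun z => f z + g z).
Proof.
move=> [f1 f2] [g1 g2]; split.
  apply: (@eq_measurable_fun _ _ _ _ _
    ((fun s => complex.Re (f (gamma s))) \+ (fun s => complex.Re (g (gamma s))))).
    by move=> s _ /=; case: (f (gamma s)) (g (gamma s)) => ? ? [].
  exact: measurable_funD.
apply: (@eq_measurable_fun _ _ _ _ _
  ((fun s => complex.Im (f (gamma s))) \+ (fun s => complex.Im (g (gamma s))))).
  by move=> s _ /=; case: (f (gamma s)) (g (gamma s)) => ? ? [].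
exact: measurable_funD.
Qed.

Lemma measC_onM f g : measC_on L gamma f -> measC_on L gamma g ->
  measC_on L gamma (fun z => f z * g z).
Proof.
move=> [f1 f2] [g1 g2]; split.
  apply: (@eq_measurable_fun _ _ _ _ _
    (((fun s => complex.Re (f (gamma s))) \* (fun s => complex.Re (g (gamma s))))
     \- ((fun s => complex.Im (f (gamma s))) \* (fun s => complex.Im (g (gamma s)))))).
    by move=> s _ /=; case: (f (gamma s)) (g (gamma s)) => ? ? [].
  by apply: measurable_funB; apply: measurable_funM.
apply: (@eq_measurable_fun _ _ _ _ _
  (((fun s => complex.Re (f (gamma s))) \* (fun s => complex.Im (g (gamma s))))
   \+ ((fun s => complex.Im (f (gamma s))) \* (fun s => complex.Re (g (gamma s)))))).
  by move=> s _ /=; case: (f (gamma s)) (g (gamma s)) => ? ? [].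
by apply: measurable_funD; apply: measurable_funM.
Qed.

Lemma measC_on_cst (w : R[i]) : measC_on L gamma (fun=> w).
Proof. by split; exact: measurable_cst. Qed.

Lemma mfun_on_nc f : measC_on L gamma f -> mfun_on L gamma (fun z => nc (f z)).
Proof.
move=> [f1 f2]; split; last by move=> z; exact: nc_ge0.
apply: (@eq_measurable_fun _ _ _ _ _
  (@Num.sqrt R \o (((fun s => complex.Re (f (gamma s))) \* (fun s => complex.Re (f (gamma s))))
  \+ ((fun s => complex.Im (f (gamma s))) \* (fun s => complex.Im (f (gamma s))))))).
  by move=> s _ /=; case: (f (gamma s)) => x y /=; rewrite -!expr2.
apply: measurableT_comp; first by apply: continuous_measurable_fun; exact: sqrt_continuous.
by apply: measurable_funD; apply: measurable_funM.
Qed.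

Lemma mfun_onD (f g : R[i] -> R) : mfun_on L gamma f -> mfun_on L gamma g ->
  mfun_on L gamma (fun z => f z + g z).
Proof.
move=> [f1 f0] [g1 g0]; split; last by move=> z; rewrite addr_ge0.
exact: measurable_funD.
Qed.

Lemma mfun_onZ (c : R) (f : R[i] -> R) : 0 <= c -> mfun_on L gamma f ->
  mfun_on L gamma (fun z => c * f z).
Proof.
move=> c0 [f1 f0]; split; last by move=> z; rewrite mulr_ge0.
by apply: measurable_funM => //; exact: measurable_cst.
Qed.

Hypothesis bfn : banach_function_norm L gamma rho.

Lemma rho_ge0 (f : R[i] -> R) : mfun_on L gamma f -> (0 <= rho f)%E.
Proof. by case: bfn => + _; exact. Qed.

Lemma rho_eq0 (f : R[i] -> R) : mfun_on L gamma f ->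
  (rho f = 0%E <-> ae_on L gamma (fun z => f z = 0)).
Proof. by case: bfn => _ [+ _]; exact. Qed.

Lemma rhoZ (c : R) (f : R[i] -> R) : mfun_on L gamma f -> 0 <= c ->
  rho (fun z => c * f z) = (c%:E * rho f)%E.
Proof. by case: bfn => _ [_ [+ _]]; exact. Qed.

Lemma rhoD (f g : R[i] -> R) : mfun_on L gamma f -> mfun_on L gamma g ->
  (rho (fun z => (f z + g z)%R) <= rho f + rho g)%E.
Proof. by case: bfn => _ [_ [_ [+ _]]]; exact. Qed.

Lemma le_rho (f g : R[i] -> R) : mfun_on L gamma f -> mfun_on L gamma g ->
  ae_on L gamma (fun z => g z <= f z) -> (rho g <= rho f)%E.
Proof. by case: bfn => _ [_ [_ [_ [+ _]]]]; exact. Qed.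

Lemma rho_indic_lty E : meas_set_on L gamma E -> (rho (\1_E) < +oo)%E.
Proof. by case: bfn => _ [_ [_ [_ [_ [_ [+ _]]]]]]; exact. Qed.

Lemma normX_ge0 f : measC_on L gamma f -> 0 <= normX rho f.
Proof. by move=> mf; rewrite /normX fine_ge0// rho_ge0//; exact: mfun_on_nc. Qed.

Lemma rho_normX f : inX L gamma rho f ->
  rho (fun z => nc (f z)) = (normX rho f)%:E.
Proof.
move=> [mf flt]; rewrite /normX fineK// ge0_fin_numE//.
by apply: rho_ge0; exact: mfun_on_nc.
Qed.

Lemma inX_le f (M : R) : measC_on L gamma f ->
  (rho (fun z => nc (f z)) <= M%:E)%E -> inX L gamma rho f /\ normX rho f <= M.
Proof.
move=> mf fM; have Xf : inX L gamma rho f.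
  by split => //; apply: le_lt_trans fM _; exact: ltry.
by split => //; rewrite -lee_fin -rho_normX.
Qed.

Lemma inX_mul c f (M : R) : 0 <= M -> measC_on L gamma c ->
  ae_on L gamma (fun z => nc (c z) <= M) -> inX L gamma rho f ->
  inX L gamma rho (fun z => c z * f z) /\
  normX rho (fun z => c z * f z) <= M * normX rho f.
Proof.
move=> M0 mc cM Xf; have [mf _] := Xf; apply: inX_le; first exact: measC_onM.
rewrite EFinM -rho_normX// -rhoZ//; last exact: mfun_on_nc.
apply: le_rho; first by apply: mfun_onZ => //; exact: mfun_on_nc.
  by apply: mfun_on_nc; exact: measC_onM.
by apply: ae_on_imp cM => s _ h; rewrite ncM ler_wpM2r// nc_ge0.
Qed.

Lemma inX_add f g : inX L gamma rho f -> inX L gamma rho g ->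
  inX L gamma rho (fun z => f z + g z) /\
  normX rho (fun z => f z + g z) <= normX rho f + normX rho g.
Proof.
move=> Xf Xg; have [mf _] := Xf; have [mg _] := Xg.
apply: inX_le; first exact: measC_onD.
rewrite EFinD -!rho_normX//.
apply: le_trans (rhoD _ _ (mfun_on_nc _ mf) (mfun_on_nc _ mg)).
apply: le_rho; first by apply: mfun_onD; exact: mfun_on_nc.
  by apply: mfun_on_nc; exact: measC_onD.
by apply: ae_on_all => s _; exact: ncD.
Qed.

Lemma normX_eq0 f : inX L gamma rho f -> normX rho f = 0 ->
  ae_on L gamma (fun z => f z = 0).
Proof.
move=> Xf f0; have [mf _] := Xf.
have /(rho_eq0 _ (mfun_on_nc _ mf)) : rho (fun z => nc (f z)) = 0%E.
  by rewrite rho_normX// f0.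
by apply: ae_on_imp => s _ /eqP; rewrite nc_eq0 => /eqP.
Qed.

Lemma normX_ae0 f : measC_on L gamma f -> ae_on L gamma (fun z => f z = 0) ->
  normX rho f = 0.
Proof.
move=> mf f0; rewrite /normX (_ : rho _ = 0%E)//.
apply/(rho_eq0 _ (mfun_on_nc _ mf)).
by apply: ae_on_imp f0 => s _ ->; rewrite nc0.
Qed.

Local Notation blo := (bounded_linear_op L gamma rho).

Lemma blo_bound T : blo T -> exists2 K : R, 0 <= K &
  forall f, inX L gamma rho f -> normX rho (T f) <= K * normX rho f.
Proof.
move=> [_ _ _ [K HK]]; exists `|K| => // f Xf; have [mf _] := Xf.
by rewrite (le_trans (HK _ Xf))// ler_wpM2r ?normX_ge0// ler_norm.
Qed.

Lemma inX_scale (w : R[i]) f : inX L gamma rho f ->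
  inX L gamma rho (fun z => w * f z).
Proof.
move=> Xf; have [] // := @inX_mul (fun=> w) f (nc w) (nc_ge0 _) _ _ Xf.
  exact: measC_on_cst.
exact: ae_on_all.
Qed.

(** Operators act on functions, not on classes, and are linear only almost everywhere. Compatibility
    with almost everywhere equality still follows, since T(f - g) has norm 0. Every composition of
    right inverses relies on this. *)
Lemma blo_ae_eq T f g : blo T -> inX L gamma rho f -> inX L gamma rho g ->
  ae_on L gamma (fun z => f z = g z) -> ae_on L gamma (fun z => T f z = T g z).
Proof.
move=> bT Xf Xg fg; have [TX TD TZ _] := bT; have [K K0 HK] := blo_bound _ bT.
have XNg := inX_scale (-1) _ Xg; have [Xd _] := inX_add _ _ Xf XNg.
have d0 : normX rho (fun z => f z + (-1) * g z) = 0.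
  apply: normX_ae0; first by case: Xd.
  by apply: ae_on_imp fg => s _ ->; rewrite mulN1r subrr.
have Td0 : normX rho (T (fun z => f z + (-1) * g z)) = 0.
  apply/eqP; rewrite eq_le normX_ge0 ?andbT; last by case: (TX _ Xd).
  by rewrite (le_trans (HK _ Xd))// d0 mulr0.
have := ae_on_and _ _ (normX_eq0 _ (TX _ Xd) Td0)
  (ae_on_and _ _ (TD _ _ Xf XNg) (TZ (-1) _ Xg)).
apply: ae_on_imp => s _ [h0 [hD hZ]].
by move: h0; rewrite hD hZ mulN1r => /eqP; rewrite subr_eq0 => /eqP.
Qed.

Lemma blo_id : blo id.
Proof.
split => //; [by move=> *; exact: ae_on_all|by move=> *; exact: ae_on_all|].
by exists 1 => f _; rewrite mul1r.
Qed.

Lemma blo_mul c (M : R) : measC_on L gamma c ->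
  ae_on L gamma (fun z => nc (c z) <= M) -> blo (fun f z => c z * f z).
Proof.
move=> mc cM.
have cM' : ae_on L gamma (fun z => nc (c z) <= `|M|).
  by apply: ae_on_imp cM => s _ h; rewrite (le_trans h)// ler_norm.
split.
- by move=> f Xf; have [] := inX_mul c f `|M| (normr_ge0 _) mc cM' Xf.
- by move=> f g _ _; apply: ae_on_all => s _; rewrite mulrDr.
- by move=> w f _; apply: ae_on_all => s _; rewrite mulrCA.
- by exists `|M| => f Xf; have [] := inX_mul c f `|M| (normr_ge0 _) mc cM' Xf.
Qed.

Lemma blo_comp T S : blo T -> blo S -> blo (fun f => T (S f)).
Proof.
move=> bT bS; have [TX TD TZ _] := bT; have [SX SD SZ _] := bS.
have [K K0 HK] := blo_bound _ bT; have [K' K0' HK'] := blo_bound _ bS.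
split.
- by move=> f /SX /TX.
- move=> f g Xf Xg; have [XfDg _] := inX_add _ _ Xf Xg.
  have [XSfDg _] := inX_add _ _ (SX _ Xf) (SX _ Xg).
  have := ae_on_and _ _ (blo_ae_eq _ _ _ bT (SX _ XfDg) XSfDg (SD _ _ Xf Xg))
    (TD _ _ (SX _ Xf) (SX _ Xg)).
  by apply: ae_on_imp => s _ [-> ->].
- move=> w f Xf; have Xw := inX_scale w _ Xf.
  have XSw := inX_scale w _ (SX _ Xf).
  have := ae_on_and _ _ (blo_ae_eq _ _ _ bT (SX _ Xw) XSw (SZ w _ Xf))
    (TZ w _ (SX _ Xf)).
  by apply: ae_on_imp => s _ [-> ->].
- exists (K * K') => f Xf.
  by rewrite (le_trans (HK _ (SX _ Xf)))// -mulrA ler_wpM2l// HK'.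
Qed.

Lemma blo_add T S : blo T -> blo S -> blo (fun f z => T f z + S f z).
Proof.
move=> bT bS; have [TX TD TZ _] := bT; have [SX SD SZ _] := bS.
have [K K0 HK] := blo_bound _ bT; have [K' K0' HK'] := blo_bound _ bS.
split.
- by move=> f Xf; have [] := inX_add _ _ (TX _ Xf) (SX _ Xf).
- move=> f g Xf Xg; have := ae_on_and _ _ (TD _ _ Xf Xg) (SD _ _ Xf Xg).
  by apply: ae_on_imp => s _ [-> ->]; rewrite addrACA.
- move=> w f Xf; have := ae_on_and _ _ (TZ w _ Xf) (SZ w _ Xf).
  by apply: ae_on_imp => s _ [-> ->]; rewrite mulrDr.
- exists (K + K') => f Xf; have [_] := inX_add _ _ (TX _ Xf) (SX _ Xf).
  by move=> /le_trans; apply; rewrite mulrDl lerD ?HK ?HK'.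
Qed.

Lemma right_invertible_comp T S : blo T -> blo S ->
  right_invertible L gamma rho T -> right_invertible L gamma rho S ->
  right_invertible L gamma rho (fun f => T (S f)).
Proof.
move=> bT bS [T' bT' hT] [S' bS' hS]; exists (fun f => S' (T' f)).
  exact: blo_comp.
move=> f Xf; have [T'X _ _ _] := bT'; have [S'X _ _ _] := bS'.
have [SX _ _ _] := bS.
have := ae_on_and _ _ (hT _ Xf)
  (blo_ae_eq _ _ _ bT (SX _ (S'X _ (T'X _ Xf))) (T'X _ Xf) (hS _ (T'X _ Xf))).
by apply: ae_on_imp => s _ [<- ->].
Qed.

(** These are the properties of a change of variable that make composition with it a bounded
    operator. The second clause allows an identity that holds almost everywhere, such as that of a
    right inverse, to be composed with [al]. *)
Definition composable (al : R[i] -> R[i]) : Prop :=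
  [/\ (forall f : R[i] -> R, meas_on L gamma f -> meas_on L gamma (f \o al)),
      (forall P, ae_on L gamma P -> ae_on L gamma (P \o al))
    & exists2 K : R, 0 <= K & forall f : R[i] -> R, mfun_on L gamma f ->
        (rho (f \o al) <= K%:E * rho f)%E].

Definition bounded_coef (c : R[i] -> R[i]) : Prop :=
  measC_on L gamma c /\ exists M : R, ae_on L gamma (fun z => nc (c z) <= M).

Lemma blo_coef c : bounded_coef c -> blo (fun f z => c z * f z).
Proof. by move=> [mc [M cM]]; exact: blo_mul cM. Qed.

(** * Right inverses of aI - bW for a composable change of variable *)

Section Composition.
Context {al : R[i] -> R[i]}.
Hypothesis cal : composable al.

Lemma measC_on_comp f : measC_on L gamma f -> measC_on L gamma (f \o al).
Proof. by case: cal => h _ _ [f1 f2]; split; [apply: (h _ f1)|apply: (h _ f2)]. Qed.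

Lemma blo_composition : blo (fun f => f \o al).
Proof.
have [mal _ [K K0 HK]] := cal.
have X f : inX L gamma rho f ->
    inX L gamma rho (f \o al) /\ normX rho (f \o al) <= K * normX rho f.
  move=> Xf; have [mf _] := Xf; apply: inX_le; first exact: measC_on_comp.
  by rewrite EFinM -rho_normX//; apply: HK; exact: mfun_on_nc.
split.
- by move=> f /X[].
- by move=> f g _ _; exact: ae_on_all.
- by move=> w f _; exact: ae_on_all.
- by exists K => f /X[].
Qed.

Lemma bounded_coefM c d : bounded_coef c -> bounded_coef d ->
  bounded_coef (fun z => c z * d z).
Proof.
move=> [mc [M cM]] [md [N dN]]; split; first exact: measC_onM.
exists (M * N); have := ae_on_and _ _ cM dN; apply: ae_on_imp => s _ [h1 h2].
by rewrite ncM ler_pM// nc_ge0.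
Qed.

Lemma bounded_coef_cst (w : R[i]) : bounded_coef (fun=> w).
Proof. by split; [exact: measC_on_cst|exists (nc w); exact: ae_on_all]. Qed.

Lemma blo_opA a b : bounded_coef a -> bounded_coef b -> blo (opA a b al).
Proof.
move=> ca cb; rewrite (_ : opA a b al =
    fun f z => a z * f z + (-1) * (b z * (f \o al) z)); last first.
  by apply/funext => f; apply/funext => z; rewrite /opA mulN1r.
apply: (blo_add _ _ (blo_coef _ ca)).
apply: (blo_comp _ _ (blo_coef _ (bounded_coef_cst (-1)))).
exact: (blo_comp _ _ (blo_coef _ cb) blo_composition).
Qed.

Local Notation rinv := (right_invertible L gamma rho).

(* If aI - bW had a right inverse, the indicator of a small arc on which
   |a|, |b| <= e would have norm at most C e times itself. *)
Lemma right_invertible_coef_far0 a b : bounded_coef a -> bounded_coef b ->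
  rinv (opA a b al) ->
  exists2 e : R, 0 < e & forall E : set R[i], meas_set_on L gamma E ->
    ~ ae_on L gamma (fun z => ~ E z) ->
    ~ (forall z, E z -> nc (a z) <= e /\ nc (b z) <= e).
Proof.
move=> ca cb [T bT hT]; have [K K0 HK] := blo_bound _ bT.
have [W W0 HW] := blo_bound _ blo_composition.
(* [K] bounds the right inverse and [W] the composition. On the arc |y| <= e (|Ty| + |Ty o al|), so
   the norm of y is at most e (1 + W) K times itself, and e is chosen to make this factor less than
   1. *)
have C0 : 0 < 2 * ((1 + W) * K + 1).
  by rewrite mulr_gt0// ltr_wpDl// mulr_ge0// addr_ge0.
exists (2 * ((1 + W) * K + 1))^-1; first by rewrite invr_gt0.
move=> E mE nE small; set e := _^-1 in small.
pose y : R[i] -> R[i] := fun z => ((\1_E z)%:C)%C.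
have ncy : (fun z => nc (y z)) = \1_E.
  by apply/funext => z; rewrite /y nc_real ger0_norm// indicE; case: (_ \in _).
have Xy : inX L gamma rho y.
  split; last by rewrite ncy; exact: rho_indic_lty.
  split; last exact: measurable_cst.
  apply: (@eq_measurable_fun _ _ _ _ _ (\1_(period_set L `&` gamma @^-1` E) : R -> R)).
    by move=> s Ls; rewrite /y/= !indicE in_setI Ls.
  exact: measurable_indic.
have [TX _ _ _] := bT; have XTy := TX _ Xy; have [my _] := Xy.
have [WX _ _ _] := blo_composition; have XWTy := WX _ XTy.
have yn0 : 0 < normX rho y.
  rewrite lt0r normX_ge0// andbT; apply/negP => /eqP /(normX_eq0 _ Xy) h.
  apply: nE; apply: ae_on_imp h => s _; rewrite /y indicE => /eqP.
  rewrite eq_complex/= eqxx andbT => + Es; rewrite mem_set//.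
  by rewrite oner_eq0.
have e0 : 0 <= e by rewrite invr_ge0 ltW.
have : normX rho y <= e * (normX rho (T y) + normX rho (T y \o al)).
  have mS : mfun_on L gamma (fun z => nc (T y z) + nc (T y (al z))).
    by apply: mfun_onD; apply: mfun_on_nc; [case: XTy|case: XWTy].
  rewrite -lee_fin -rho_normX// EFinM EFinD -!rho_normX//.
  apply: (@le_trans _ _ (rho (fun z => e * (nc (T y z) + nc (T y (al z)))))).
    apply: le_rho; [exact: mfun_onZ|exact: mfun_on_nc|].
    have := hT _ Xy; apply: ae_on_imp => s _ h.
    have [Es|nEs] := pselect (E (gamma s)); last first.
      by rewrite /y indicE memNset// nc0 mulr_ge0// addr_ge0 ?nc_ge0.
    have [h1 h2] := small _ Es.
    rewrite -h /opA (le_trans (ncB _ _))// !ncM mulrDr lerD//.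
      by rewrite ler_wpM2r// nc_ge0.
    by rewrite ler_wpM2r// nc_ge0.
  rewrite rhoZ//; apply: lee_wpmul2l; first by rewrite lee_fin.
  by apply: rhoD; apply: mfun_on_nc; [case: XTy|case: XWTy].
have h1 := HK _ Xy; have h2 := HW _ XTy.
have : normX rho (T y) + normX rho (T y \o al) <= ((1 + W) * K) * normX rho y.
  apply: (@le_trans _ _ ((1 + W) * normX rho (T y))).
    by rewrite mulrDl mul1r lerD2l.
  by rewrite -mulrA ler_wpM2l// addr_ge0.
move=> h3 h4; have := le_trans h4 (ler_wpM2l e0 h3).
rewrite mulrA -[leLHS]mul1r ler_pM2r// mulrC ler_pdivlMr// mul1r.
have : 0 <= (1 + W) * K by rewrite mulr_ge0// addr_ge0.
lra.
Qed.

(* With ac + bd = 1 and p a solution of ap - b(p o al) = bg, the function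
   s = c(p o al + g) + dp satisfies bs = p and as = p o al + g. *)
Lemma right_invertible_shift a b c d : bounded_coef a -> bounded_coef b ->
  bounded_coef c -> bounded_coef d ->
  (forall s, period_set L s ->
    a (gamma s) * c (gamma s) + b (gamma s) * d (gamma s) = 1) ->
  rinv (opA a b al) -> rinv (opA a (b \o al) al).
Proof.
move=> ca cb cc cd acbd [T bT hT].
have [_ alae _] := cal.
have bp := blo_comp _ _ bT (blo_coef _ cb).
have bWp := blo_comp _ _ blo_composition bp.
exists (fun g z => c z * ((T (fun w => b w * g w) \o al) z + g z)
                 + d z * T (fun w => b w * g w) z).
  apply: blo_add; last exact: (blo_comp _ _ (blo_coef _ cd) bp).
  by apply: (blo_comp _ _ (blo_coef _ cc)); exact: (blo_add _ _ bWp blo_id).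
move=> g Xg; have [bX _ _ _] := blo_coef _ cb.
have H := hT _ (bX _ Xg); set p := T _ in H *.
have acbd' : ae_on L gamma (fun z => a z * c z + b z * d z = 1).
  exact: ae_on_all.
have H1 := ae_on_and _ _ acbd' H.
have H2 : ae_on L gamma (fun z => b z * (c z * (p (al z) + g z) + d z * p z) = p z).
  apply: ae_on_imp H1 => s _; rewrite /opA; set z := gamma s => -[h1 h2].
  have h3 : a z * p z = b z * (p (al z) + g z) by rewrite mulrDr -h2; ring.
  rewrite mulrDr mulrCA -h3 -[RHS]mul1r -h1; ring.
have H3 := ae_on_and _ _ H1 (alae _ H2).
apply: ae_on_imp H3 => s _; rewrite /opA /=; set z := gamma s => -[[h1 h2] h4].
rewrite h4.
have h3 : a z * p z = b z * (p (al z) + g z) by rewrite mulrDr -h2; ring.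
rewrite mulrDr [a z * (d z * p z)]mulrCA h3.
transitivity ((a z * c z + b z * d z) * (p (al z) + g z) - p (al z)); first ring.
by rewrite h1; ring.
Qed.

(** Conjugation by multiplication with u turns bW into b (u / u o al) W, and the quotient is w. *)
Lemma right_invertible_gauge a b u (w : R[i]) :
  measC_on L gamma u -> ae_on L gamma (fun z => nc (u z) = 1) ->
  ae_on L gamma (fun z => w * u (al z) = u z) ->
  rinv (opA a b al) -> rinv (opA a (fun z => w * b z) al).
Proof.
move=> mu nu uw [T bT hT].
(* The conjugate is the inverse of u almost everywhere, because |u| = 1, and its measurability is
   immediate. *)
pose v z := (u z)^*%C.
have mv : measC_on L gamma v.
  have [u1 u2] := mu; split.
    apply: (@eq_measurable_fun _ _ _ _ _ (fun s => complex.Re (u (gamma s)))) => //.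
    by move=> s _; rewrite /v/=; case: (u _).
  apply: (@eq_measurable_fun _ _ _ _ _ (fun s => - complex.Im (u (gamma s)))).
    by move=> s _; rewrite /v/=; case: (u _).
  exact: measurableT_comp.
have bu : bounded_coef u.
  by split => //; exists 1; apply: ae_on_imp nu => s _ ->.
have bv : bounded_coef v.
  by split => //; exists 1; apply: ae_on_imp nu => s _; rewrite nc_conj => ->.
have bTv := blo_comp _ _ bT (blo_coef _ bv).
exists (fun f z => u z * T (fun x => v x * f x) z).
  exact: (blo_comp _ _ (blo_coef _ bu) bTv).
move=> f Xf; have [vX _ _ _] := blo_coef _ bv.
have := ae_on_and _ _ (hT _ (vX _ Xf)) (ae_on_and _ _ nu uw).
apply: ae_on_imp => s _; rewrite /opA; set z := gamma s.
set p := T _ => -[h1 [h2 h3]].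
have uv : u z * v z = 1 by rewrite /v mulc_conj h2 expr1n.
transitivity (u z * (a z * p z - b z * p (al z))).
  by rewrite -{2}h3 mulrBr; rewrite -{1}h3; ring.
by rewrite h1 mulrA uv mul1r.
Qed.

End Composition.

Section Conjugation.
Context {al be : R[i] -> R[i]}.
Hypotheses (cal : composable al) (cbe : composable be).
Hypothesis beK : forall s, period_set L s -> al (be (gamma s)) = gamma s.
Hypothesis alK : forall s, period_set L s -> be (al (gamma s)) = gamma s.
Local Notation rinv := (right_invertible L gamma rho).

Lemma right_invertible_conj a b :
  rinv (opA a b al) -> rinv (opA (a \o al) (b \o al) al).
Proof.
move=> [T bT hT]; exists (fun f => T (f \o be) \o al).
  apply: (blo_comp _ _ (blo_composition cal)).
  exact: (blo_comp _ _ bT (blo_composition cbe)).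
move=> f Xf; have [beX _ _ _] := blo_composition cbe; have [_ alae _] := cal.
have := alae _ (hT _ (beX _ Xf)); apply: ae_on_imp => s Ls.
by rewrite /opA /= alK.
Qed.

Lemma right_invertible_unconj a b :
  rinv (opA (a \o al) (b \o al) al) -> rinv (opA a b al).
Proof.
move=> [T bT hT]; exists (fun f => T (f \o al) \o be).
  apply: (blo_comp _ _ (blo_composition cbe)).
  exact: (blo_comp _ _ bT (blo_composition cal)).
move=> f Xf; have [alX _ _ _] := blo_composition cal; have [_ beae _] := cbe.
have := beae _ (hT _ (alX _ Xf)); apply: ae_on_imp => s Ls.
by rewrite /opA /= beK// alK.
Qed.

End Conjugation.
End FunctionSpace.

(** * Factorization of A_m over the m-th roots of unity *)

Section Factorization.
Context {R : realType}.
Variables (a b al : R[i] -> R[i]) (N : nat).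

(** In the factor at position i, after p choices of bW, the coefficient a is evaluated at
    alpha_(k-i+p)(z) and b at alpha_(N+p)(z). The first depends only on the number i - p of choices
    of a made before, the second only on p. The truncation of [k.-1] at 0 is the reason for the
    bound on [size ws] in the expansion below. *)
Fixpoint factors (k : nat) (ws : seq R[i]) (f : R[i] -> R[i]) : R[i] -> R[i] :=
  if ws is w :: ws' then
    opA (a \o iter k al) (fun z => w * b (iter N al z)) al (factors k.-1 ws' f)
  else f.

(* Moving the coefficients to the left, every choice of k factors bW in the
   product yields the same coefficient, hence only symmetric functions of ws
   remain. *)
Lemma factorsE ws k f z : (size ws <= k.+1)%N ->
  factors k ws f z = \sum_(j < (size ws).+1)
    (\prod_(w <- ws) ('X - w%:P))`_j * (\prod_(r < j) a (iter (k - r) al z)) *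
    iprod al b (size ws - j) (iter N al z) * f (iter (size ws - j) al z).
Proof.
elim: ws k z => [|w ws IH] k z sz.
  by rewrite big_ord_recl big_ord0 /= !big_nil coef1 /= /iprod !big_ord0 !mulr1 mul1r addr0.
rewrite /= /opA; set n := size ws in sz IH *.
pose q := \prod_(w <- ws) ('X - w%:P).
(* [T j] is the common value of all terms with j choices of a. Choosing a in the head factor raises
   j by one, like multiplication by 'X ([e1]); choosing bW keeps j and contributes -w ([e2]).
   Together they multiply [q] by 'X - w. *)
pose T j := (\prod_(r < j) a (iter (k - r) al z)) *
    iprod al b (n.+1 - j) (iter N al z) * f (iter (n.+1 - j) al z).
have sz' : (n <= k.-1.+1)%N by move: sz; rewrite /=; case: (k) => //= /ltnW.
have qs : size q = n.+1 by rewrite size_prod_XsubC.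
have e1 : a (iter k al z) * factors k.-1 ws f z = \sum_(j < n.+1) q`_j * T j.+1.
  rewrite IH// mulr_sumr; apply: eq_bigr => j _.
  rewrite /T big_ord_recl subn0 subSS.
  have -> : \prod_(i < j) a (iter (k - lift ord0 i) al z) =
            \prod_(r < j) a (iter (k.-1 - r) al z).
    by apply: eq_bigr => i _; rewrite lift0 -subn1 -subnDA add1n.
  rewrite -/q; ring.
have e2 : w * b (iter N al z) * factors k.-1 ws f (al z) =
          w * \sum_(j < n.+1) q`_j * T j.
  rewrite IH// -mulrA; congr (_ * _); rewrite mulr_sumr; apply: eq_bigr => j _.
  have jn : (j <= n)%N by rewrite -ltnS.
  rewrite /T (subSn jn) /iprod big_ord_recl /=.
  rewrite -!iterSr -iterS.
  have -> : \prod_(r < j) a (iter (k - r) al z) =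
            \prod_(r < j) a (iter (k.-1 - r) al (al z)).
    apply: eq_bigr => r _; rewrite -iterSr.
    have rj := ltn_ord r; case: (k) sz => [|k'] /= sz.
      by move: (leq_trans rj (leq_trans jn sz)).
    by rewrite subSn// -ltnS; apply: leq_trans rj (leq_trans jn _).
  have -> : \prod_(i < n - j) b (iter (lift ord0 i) al (iter N al z)) =
            \prod_(i < n - j) b (iter i al (iter N.+1 al z)).
    by apply: eq_bigr => i _; rewrite lift0 iterSr -iterS.
  by rewrite -/q; ring.
rewrite e1 e2 big_cons -/q.
transitivity (\sum_(j < n.+2) (('X - w%:P) * q)`_j * T j); last first.
  by apply: eq_bigr => j _; rewrite /T !mulrA.
have cE j : (('X - w%:P) * q)`_j = (if j == 0%N then 0 else q`_j.-1) - w * q`_j.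
  by rewrite mulrBl coefB coefXM coefCM.
rewrite [RHS](eq_bigr (fun j : 'I_n.+2 =>
    (if j == 0%N :> nat then 0 else q`_j.-1) * T j - w * q`_j * T j)); last first.
  by move=> j _; rewrite cE mulrBl.
rewrite sumrB [in RHS]big_ord_recl /= mul0r add0r; congr (_ - _).
rewrite [RHS]big_ord_recr /= (nth_default 0 (s:=q)) ?qs// mulr0 mul0r addr0 mulr_sumr.
by apply: eq_bigr => j _; rewrite mulrA.
Qed.

End Factorization.

(** Only the coefficients of degree 0 and m of X^m - 1 survive in the expansion: the first gives the
    term in W^m, the last gives a_m. *)
Lemma opAm_factors (R : realType) (a b al : R[i] -> R[i]) (m : nat) (ws : seq R[i]) :
  (0 < m)%N -> \prod_(w <- ws) ('X - w%:P) = 'X^m - 1 ->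
  opAm m a b al = factors a b al m.-1 m.-1 ws.
Proof.
move=> m0 Hws; have sz : size ws = m.
  have := congr1 (fun p : {poly R[i]} => size p) Hws.
  by rewrite size_prod_XsubC size_XnsubC// => -[].
case: m m0 Hws sz => // n _ Hws sz; apply/funext => f; apply/funext => z.
rewrite factorsE ?sz// Hws big_ord_recl big_ord_recr /= !coefB !coefXn !coef1 /=.
rewrite big_ord0 [X in _ + (X + _)]big1 => [|i _]; last first.
  rewrite coefB coefXn coef1 /= /bump /= add1n eqSS (ltn_eqF (ltn_ord i)).
  by rewrite subrr !mul0r.
rewrite /opAm /bump /= add1n eqxx subnn subn0 subr0 sub0r add0r mulr1.
rewrite /iprod [in X in _ = _ + X]big_ord0 !mul1r mulr1 mulN1r mulNr addrC /=.
(* The expansion lists the values of [a] from alpha_(m-1) down to alpha_0, the reverse of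
   [iprod]. *)
congr (- _ + _ * _); rewrite (reindex_inj rev_ord_inj) /=.
by apply: eq_bigr => i _; rewrite subSS.
Qed.

(** * From local to global on an interval *)

Section IntervalChain.
Context {R : realType}.
Local Notation nc := (@ComplexField.Normc.normc R).

(** Continuous induction: the supremum of the t with P x t is itself such a t, and it can be
    exceeded unless it equals y. This stands in for compactness of [x, y] in mean value
    inequalities, in bounds on continuous functions, in distances from an arc and in piecewise
    measure estimates. *)
Lemma interval_chain (P : R -> R -> Prop) (x y : R) : x <= y ->
  (forall u v w, u <= v -> v <= w -> P u v -> P v w -> P u w) ->
  (forall t, x <= t <= y -> exists2 d : R, 0 < d &
     forall u v, t - d < u -> u <= t -> t <= v -> v < t + d -> P u v) ->
  P x y.
Proof.
move=> xy tr loc; pose S := [set t | x <= t <= y /\ P x t].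
have Sx : S x.
  split; first by rewrite lexx.
  have [|d d0 h] := loc x; first by rewrite lexx.
  by apply: h; rewrite ?ltrBlDr ?ltrDl.
have ubS : ubound S y by move=> t [/andP[]].
have hS : has_sup S by split; [exists x|exists y].
have xT : x <= sup S by apply: ub_le_sup => //; exists y.
have Ty : sup S <= y by apply: ge_sup => //; exists x.
have [|d d0 h] := loc (sup S); first by rewrite xT.
have [t St tT] := sup_adherent d0 hS; have [/andP[xt ty] Pxt] := St.
have tT' : t <= sup S by apply: ub_le_sup => //; exists y.
have PT : P x (sup S).
  by apply: tr Pxt _ => //; apply: h => //; rewrite ltrDl.
(* A step beyond the supremum, capped at y; the cap must be the active bound. *)
pose v := Num.min y (sup S + d / 2).
have Tv : sup S <= v by rewrite /v le_min Ty lerDl divr_ge0// ltW.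
have Pv : P x v.
  apply: tr PT _ => //; apply: h => //; first by rewrite ltrBlDr ltrDl.
  by rewrite /v gt_min ltrD2l ltr_pdivrMr// mulr_natr mulr2n ltrDl d0 orbT.
have Sv : S v by split=> //; rewrite (le_trans xT Tv) /v ge_min lexx.
have : v <= sup S by apply: ub_le_sup => //; exists y.
rewrite {1}/v ge_min => /orP[yT|]; last by rewrite gerDl leNgt divr_gt0.
by have -> : y = sup S by apply/eqP; rewrite eq_le yT Ty.
Qed.

(** This replaces the mean value theorem, which fails for complex values: the local bounds, centred
    at each t, are chained by the triangle inequality. *)
Lemma locally_lipschitz_le (F : R -> R[i]) (K x y : R) : x <= y ->
  (forall t, x <= t <= y -> exists2 d : R, 0 < d & forall t', `|t' - t| < d ->
     nc (F t' - F t) <= K * `|t' - t|) ->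
  nc (F y - F x) <= K * (y - x).
Proof.
move=> xy loc; apply: (interval_chain (fun u v => nc (F v - F u) <= K * (v - u))) => //.
  move=> u v w _ _ h1 h2; rewrite -(subrKA (F v)) (le_trans (ncD _ _))//.
  by rewrite (_ : K * (w - u) = K * (w - v) + K * (v - u)) ?lerD//; ring.
move=> t /loc[d d0 h]; exists d => // u v tu ut tv vt.
rewrite -(subrKA (F t)) (le_trans (ncD _ _))//.
rewrite (_ : K * (v - u) = K * (v - t) + K * (t - u)); last ring.
apply: lerD.
  have := h v; rewrite ger0_norm ?subr_ge0//; apply; lra.
have := h u; rewrite distrC ncC ger0_norm ?subr_ge0//; apply; lra.
Qed.

Lemma rderiv_local (g : R -> R[i]) (s : R) (v : R[i]) (K : R) :
  rderiv g s v -> nc v < K -> exists2 d : R, 0 < d & forall t, `|t - s| < d ->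
    nc (g t - g s) <= K * `|t - s|.
Proof.
move=> gv vK; have [|d d0 h] := gv (K - nc v); first by rewrite subr_gt0.
exists d => // t ts; have [->|tns] := eqVneq t s.
  by rewrite !subrr nc0 normr0 mulr0.
have n0 : 0 < `|t - s| by rewrite normr_gt0 subr_eq0.
have := h (t - s); rewrite n0 ts => /(_ isT); rewrite (addrC s) subrK => h1.
have h2 : nc ((g t - g s) / ((t - s)%:C)%C) <= K.
  rewrite -[X in nc X](subrK v) (le_trans (ncD _ _))//.
  by rewrite -lerBrDr ltW.
by move: h2; rewrite ncM ncV nc_real ler_pdivrMr.
Qed.

Lemma rcont_continuousP (F : R -> R[i]) : rcont F ->
  continuous (fun s => complex.Re (F s)) /\ continuous (fun s => complex.Im (F s)).
Proof.
move=> cF; split => s; apply/cvgrPdist_lt => e e0; have [d d0 h] := cF s e e0;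
  apply/nbhs_ballP; exists d => //= t; rewrite /ball/= distrC => /h;
  apply: le_lt_trans; rewrite ncC.
- rewrite (_ : _ - _ = complex.Re (F s - F t)); first exact: Re_le_nc.
  by case: (F s) (F t) => ? ? [? ?].
- rewrite (_ : _ - _ = complex.Im (F s - F t)); first exact: Im_le_nc.
  by case: (F s) (F t) => ? ? [? ?].
Qed.

Lemma rcont_bounded (F : R -> R[i]) (x y : R) : rcont F -> x <= y ->
  exists M, forall t, x <= t <= y -> nc (F t) <= M.
Proof.
move=> cF xy.
apply: (interval_chain (fun u v => exists M, forall t, u <= t <= v -> nc (F t) <= M)) => //.
  move=> u v w _ _ [M1 h1] [M2 h2]; exists (Num.max M1 M2) => t /andP[ut tw].
  by rewrite le_max; have [tv|vt] := leP t v; [rewrite h1 ?ut|rewrite h2 ?orbT// ltW].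
move=> t _; have [d d0 h] := cF t 1 ltr01; exists d => // u v tu ut tv vt.
exists (1 + nc (F t)) => t' /andP[ut' t'v].
rewrite -[X in nc X](subrK (F t)) (le_trans (ncD _ _))// lerD2r ltW// h//.
by rewrite ltr_norml; apply/andP; split; lra.
Qed.

End IntervalChain.

(** * Measure distortion by expanding maps *)

Section ExpandingMaps.
Context {R : realType}.
Local Notation mu := (@lebesgue_measure R).

(** Cover E by open intervals. The points of A sent into an interval of length l lie within K l of
    any one of them, hence in an interval of length 2 K l centred there; this is the origin of the
    factor 2. The outer measure of E is all that enters, so E may be any set. *)
Lemma measure_preimage_expanding (A E : set R) (h : R -> R) (K : R) : 0 < K ->
  measurable A -> (forall x, A x -> E (h x)) ->
  (forall x y, A x -> A y -> `|x - y| <= K * `|h x - h y|) ->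
  (mu A <= (2 * K)%:E * mu E)%E.
Proof.
move=> K0 mA AE hK; have K20 : 0 < 2 * K by rewrite mulr_gt0.
rewrite -lee_pdivrMl//.
have -> : mu E = ereal_inf [set (\sum_(k <oo) wlength idfun (F k))%E | F in open_itv_cover E].
  by rewrite -outer_measure_open_itv_cover.
apply: le_ereal_inf_tmp => _ [F [Fitv EF] <-].
rewrite lee_pdivrMl//.
have B k : {B : set R | [/\ measurable B, A `&` h @^-1` (F k) `<=` B &
    (mu B <= (2 * K)%:E * wlength idfun (F k))%E]}.
  apply: cid; have [[p q] /= Fk] := Fitv k.
  have [[x0 [Ax0 Fx0]]|no] := pselect (exists x, A x /\ F k (h x)); last first.
    exists set0; split => //; first by move=> x [Ax Fx]; case: no; exists x.
    by rewrite measure0 mule_ge0 ?lee_fin ?(ltW K20)// wlength_ge0.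
  have pq : p < q by move: Fx0; rewrite Fk/= in_itv/= => /andP[/lt_trans]; apply.
  exists `[x0 - K * (q - p), x0 + K * (q - p)]%classic; split.
  - exact: measurable_itv.
  - move=> x [Ax]; rewrite /= Fk /= !in_itv/= => /andP[px xq].
    move: Fx0; rewrite Fk/= in_itv/= => /andP[px0 x0q].
    have : `|x - x0| <= K * (q - p).
      rewrite (le_trans (hK _ _ Ax Ax0))// ler_pM2l// ler_norml.
      by apply/andP; split; lra.
    by rewrite ler_norml => /andP[? ?]; apply/andP; split; lra.
  - rewrite lebesgue_measure_itv/= Fk wlength_itv/= !lte_fin pq.
    have -> : x0 - K * (q - p) < x0 + K * (q - p).
      have : 0 < K * (q - p) by rewrite mulr_gt0// subr_gt0.
      lra.
    by rewrite -!EFinB -EFinM lee_fin; lra.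
apply: (@le_trans _ _ (\sum_(k <oo) mu (sval (B k)))%E).
  apply: measure_sigma_subadditive => //.
    by move=> k; case: (B k) => ? [].
  move=> x Ax; have [k _ Fkx] := EF _ (AE _ Ax); exists k => //.
  by case: (B k) => ? /= [_ + _]; apply; split.
rewrite -nneseriesZl; last by move=> k _; exact: wlength_ge0.
by apply: lee_nneseries => // k _; case: (B k) => ? [].
Qed.

End ExpandingMaps.

(** * Arc length on the curve and substitution by a diffeomorphism *)

Section Curve.
Context {R : realType} {L : R} {gamma : R -> R[i]}.
Hypothesis Jordan : smooth_jordan_curve L gamma.
Local Notation nc := (@ComplexField.Normc.normc R).
Local Notation mu := (@lebesgue_measure R).
Local Notation G := (curve gamma).

Lemma length_gt0 : 0 < L.
Proof. by case: Jordan. Qed.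

Lemma gamma_period (n : int) s : gamma (s + n%:~R * L) = gamma s.
Proof.
have [_ gL _ _] := Jordan.
have gn (k : nat) t : gamma (t + k%:R * L) = gamma t.
  elim: k t => [|k IH] t; first by rewrite mul0r addr0.
  by rewrite -natr1 mulrDl mul1r addrA gL.
case: n => k; first exact: gn.
rewrite NegzE mulrNz mulNr.
by rewrite -[in RHS](subrK (k.+1%:R * L) s) gn.
Qed.

Definition reduce (s : R) : R := s - (Num.floor (s / L))%:~R * L.

Lemma reduce_period s : period_set L (reduce s).
Proof.
have L0 := length_gt0; rewrite /period_set/= /reduce subr_ge0.
have /andP[h1 h2] := mem_rg1_floor (s / L).
rewrite -ler_pdivlMr// h1/= ltrBlDl -[ltRHS]addrC -[X in _ < X + _](mul1r L).
by rewrite -mulrDl addrC -ltr_pdivrMr.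
Qed.

Lemma gamma_reduce s : gamma (reduce s) = gamma s.
Proof. by rewrite -[RHS](gamma_period (- Num.floor (s / L))) mulrNz mulNr. Qed.

Lemma gamma_inj s t : period_set L s -> period_set L t -> gamma s = gamma t -> s = t.
Proof. by case: Jordan => _ _ + _; exact. Qed.

Lemma gamma_eq s t : gamma s = gamma t -> exists n : int, s = t + n%:~R * L.
Proof.
rewrite -(gamma_reduce s) -(gamma_reduce t) => /(gamma_inj (reduce s) (reduce t)).
move=> /(_ (reduce_period s) (reduce_period t)); rewrite /reduce => h.
exists (Num.floor (s / L) - Num.floor (t / L)); rewrite mulrzBr mulrBl.
move: h; set x := _ * L; set y := _ * L; lra.
Qed.

Lemma coord_curve z : G z ->
  period_set L (Defs.coord L gamma z) /\ gamma (Defs.coord L gamma z) = z.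
Proof.
move=> [s _ <-]; apply: (@xgetPex _ 0 [set x | period_set L x /\ gamma x = gamma s]).
by exists (reduce s); split; [exact: reduce_period|exact: gamma_reduce].
Qed.

Lemma coord_gamma s : period_set L s -> Defs.coord L gamma (gamma s) = s.
Proof.
move=> Ls; have [h1 h2] := coord_curve (gamma s) (ex_intro2 _ _ s I erefl).
exact: gamma_inj.
Qed.

Lemma gamma_eq_lt x y : gamma x = gamma y -> `|x - y| < L -> x = y.
Proof.
have L_gt0 := length_gt0.
move=> /gamma_eq[n ->]; rewrite addrC addKr.
rewrite normrM (gtr0_norm L_gt0) -{2}[L]mul1r ltr_pM2r// => n1.
suff -> : n = 0 by rewrite mul0r addr0.
by move: n1; rewrite -intr_norm -[1]/(1%:~R) ltr_int; case: n => [[|n]|n].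
Qed.

Lemma coord_shift x : exists n : int, Defs.coord L gamma (gamma x) = x + n%:~R * L.
Proof.
have [_ e] := coord_curve (gamma x) (ex_intro2 _ _ x I erefl).
exact: gamma_eq.
Qed.

(** The tangent has modulus 1; any constant above 1 leaves the room that the strict inequality in
    [rderiv_local] requires. *)
Lemma gamma_lipschitz x y : nc (gamma x - gamma y) <= 2 * `|x - y|.
Proof.
wlog yx : x y / y <= x.
  move=> H; have [/H//|/ltW /H] := leP y x.
  by rewrite ncC distrC.
have [_ _ _ [g' [dg _] ng]] := Jordan.
rewrite ger0_norm ?subr_ge0//; apply: locally_lipschitz_le => // t _.
by apply: rderiv_local (dg t) _; rewrite ng ltr1n.
Qed.

(** Near p the function gamma(t) - gamma'(p) t has a derivative of modulus below 1/4, hence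
    Lipschitz constant 1/2, while the subtracted linear part is isometric. *)
Lemma gamma_expanding p : exists2 d : R, 0 < d & forall x y,
  `|x - p| < d -> `|y - p| < d -> `|x - y| <= 2 * nc (gamma x - gamma y).
Proof.
have [_ _ _ [g' [dg cg] ng]] := Jordan.
have [|d d0 hd] := cg p (4^-1); first by rewrite invr_gt0.
exists d => // x y; wlog yx : x y / y <= x.
  move=> H; have [/H//|/ltW /H {}H h1 h2] := leP y x.
  by rewrite distrC ncC H.
move=> xp yp; rewrite ger0_norm ?subr_ge0//.
pose F t := gamma t - g' p * (t%:C)%C.
have FE : F x - F y = (gamma x - gamma y) - g' p * ((x - y)%:C)%C.
  by rewrite /F rmorphB /=; ring.
have : nc (F x - F y) <= 2^-1 * (x - y).
  apply: locally_lipschitz_le => // t /andP[yt tx].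
  apply: (rderiv_local _ _ (g' t - g' p)); last first.
    apply: (@lt_trans _ _ 4^-1); last by rewrite ltf_pV2 ?posrE// ltr_nat.
    apply: hd; move: xp yp; rewrite !ltr_norml => /andP[? ?] /andP[? ?].
    by apply/andP; split; lra.
  move=> e e0; have [d' d'0 hd'] := dg t e e0; exists d' => // h hh.
  have h0 : ((h%:C)%C : R[i]) != 0.
    by rewrite -nc_gt0 nc_real; case/andP: hh.
  have := hd' _ hh; congr (nc _ < _); rewrite /F rmorphD /=.
  by field.
rewrite FE => h1.
have h2 : nc (g' p * ((x - y)%:C)%C) = x - y.
  by rewrite ncM ng mul1r nc_real ger0_norm// subr_ge0.
have := ncB (gamma x - gamma y) (gamma x - gamma y - g' p * ((x - y)%:C)%C).
rewrite opprB addrC subrK h2; lra.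
Qed.

Lemma cont_on_rcont f : cont_on G f -> rcont (f \o gamma).
Proof.
move=> cf s e e0; have [|d d0 h] := cf (gamma s) _ e e0; first by exists s.
exists (d / 2) => [|s' ss']; first by rewrite divr_gt0.
apply: h; first by exists s'.
by rewrite (le_lt_trans (gamma_lipschitz _ _))// mulrC -ltr_pdivlMr.
Qed.

Lemma cont_on_measC f : cont_on G f -> measC_on L gamma f.
Proof.
move=> /cont_on_rcont/rcont_continuousP[c1 c2]; split.
  by apply: measurable_funTS; exact: continuous_measurable_fun.
by apply: measurable_funTS; exact: continuous_measurable_fun.
Qed.

Lemma cont_on_bounded f : cont_on G f ->
  exists M, forall z, G z -> nc (f z) <= M.
Proof.
move=> /cont_on_rcont cf; have [M HM] := rcont_bounded _ 0 L cf (ltW length_gt0).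
exists M => z [s _ <-]; rewrite -gamma_reduce; apply: HM.
by have /andP[-> /ltW ->] := reduce_period s.
Qed.

Lemma cont_on_coef f : cont_on G f -> bounded_coef (L:=L) (gamma:=gamma) f.
Proof.
move=> cf; split; first exact: cont_on_measC.
have [M HM] := cont_on_bounded f cf; exists M; apply: ae_on_all => s _.
by apply: HM; exists s.
Qed.

Lemma deriv_along_local f t v : deriv_along G f t v ->
  exists2 d : R, 0 < d & forall tau, G tau -> nc (tau - t) < d ->
    nc (f tau - f t) <= (nc v + 1) * nc (tau - t).
Proof.
move=> /(_ 1 ltr01)[d d0 h]; exists d => // tau Gtau td.
have [->|ne] := eqVneq tau t; first by rewrite !subrr nc0 mulr0.
have n0 : 0 < nc (tau - t) by rewrite nc_gt0 subr_eq0.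
have := h _ Gtau; rewrite n0 td => /(_ isT) h1.
have : nc ((f tau - f t) / (tau - t)) <= nc v + 1.
  by rewrite -[X in nc X](subrK v) (le_trans (ncD _ _))// addrC lerD2l ltW.
by rewrite ncM ncV ler_pdivrMr.
Qed.

Lemma C1_on_cont f : C1_on G f -> cont_on G f.
Proof.
move=> [_ [f' df _]] t Gt e e0; have [d d0 h] := deriv_along_local _ _ _ (df t Gt).
have k0 : 0 < nc (f' t) + 1 by rewrite ltr_wpDl// nc_ge0.
exists (Num.min d (e / (nc (f' t) + 1))).
  by rewrite lt_min d0 divr_gt0.
move=> tau Gtau; rewrite lt_min => /andP[h1 h2].
by rewrite (le_lt_trans (h _ Gtau h1))// mulrC -ltr_pdivlMr.
Qed.

Lemma cont_on_comp f g : (forall z, G z -> G (g z)) -> cont_on G f -> cont_on G g ->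
  cont_on G (f \o g).
Proof.
move=> gG cf cg t Gt e e0; have [d d0 h] := cf _ (gG _ Gt) e e0.
have [d' d'0 h'] := cg _ Gt d d0; exists d' => // tau Gtau /(h' _ Gtau) ?.
by apply: h => //; exact: gG.
Qed.

(** In the constant, M bounds the derivative along the curve, the 1 is the slack of the local
    estimate, and the 2 converts chords into parameter differences. *)
Lemma C1_on_lipschitz f : C1_on G f -> exists2 K : R, 0 < K &
  forall x y, nc (f (gamma x) - f (gamma y)) <= K * `|x - y|.
Proof.
move=> [fG [f' df cf']]; have [M HM] := cont_on_bounded _ cf'.
have M0 : 0 <= M by apply: le_trans (nc_ge0 _) (HM (gamma 0) _); exists 0.
exists ((M + 1) * 2) => [|x y]; first by rewrite mulr_gt0// ltr_wpDl.
wlog yx : x y / y <= x.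
  move=> H; have [/H//|/ltW /H] := leP y x.
  by rewrite ncC distrC.
rewrite ger0_norm ?subr_ge0//.
apply: (@locally_lipschitz_le _ (f \o gamma)) => // t _ /=.
have Gt : G (gamma t) by exists t.
have [d d0 h] := deriv_along_local _ _ _ (df _ Gt).
exists (d / 2) => [|t' tt']; first by rewrite divr_gt0.
have gg := gamma_lipschitz t' t.
apply: le_trans (h _ _ _) _; first by exists t'.
  by rewrite (le_lt_trans gg)// mulrC -ltr_pdivlMr.
by rewrite -mulrA ler_pM// ?addr_ge0 ?nc_ge0// lerD2r HM.
Qed.

(** A closed arc is at positive distance from a point off it, so avoiding the arc is an open
    condition. This gives access to the parameter of a moving point of the curve although [coord]
    jumps at gamma(0). *)
Lemma off_arc_open (F : R -> R[i]) (c d s : R) : rcont F ->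
  (forall x, c <= x <= d -> F s != gamma x) ->
  exists2 e : R, 0 < e & forall t, `|t - s| < e ->
    forall x, c <= x <= d -> F t != gamma x.
Proof.
move=> cF off; have [cd|dc] := leP c d; last first.
  by exists 1 => // t _ x /andP[/le_trans h /h]; rewrite leNgt dc.
have [e e0 He] : exists2 e : R, 0 < e &
    forall x, c <= x <= d -> e <= nc (F s - gamma x).
  apply: (interval_chain (fun u v => exists2 e : R, 0 < e &
    forall x, u <= x <= v -> e <= nc (F s - gamma x))) => //.
    move=> u v w _ _ [e1 e10 h1] [e2 e20 h2]; exists (Num.min e1 e2).
      by rewrite lt_min e10.
    move=> x /andP[ux xw]; rewrite ge_min.
    by have [xv|vx] := leP x v; [rewrite h1 ?ux|rewrite h2 ?orbT// ltW].
  move=> t td; have e0 : 0 < nc (F s - gamma t) by rewrite nc_gt0 subr_eq0 off.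
  exists (nc (F s - gamma t) / 4); first by rewrite divr_gt0.
  move=> u v tu ut tv vt; exists (nc (F s - gamma t) / 2); first by rewrite divr_gt0.
  move=> x /andP[ux xv].
  have xt : `|x - t| < nc (F s - gamma t) / 4.
    by rewrite ltr_norml; apply/andP; split; lra.
  have := gamma_lipschitz x t.
  have := ncD (F s - gamma x) (gamma x - gamma t); rewrite subrKA; lra.
have [d' d'0 h] := cF s e e0; exists d' => // t /h ht x /He hx.
by apply: contraTneq ht => ->; rewrite -leNgt ncC.
Qed.

Section Substitution.
Variables al be : R[i] -> R[i].
Hypotheses (C1al : C1_on G al) (C1be : C1_on G be).
Hypothesis alK : forall t, G t -> be (al t) = t.

Let h s := Defs.coord L gamma (al (gamma s)).

Let hP s : period_set L (h s) /\ gamma (h s) = al (gamma s).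
Proof. by apply: coord_curve; case: C1al => + _; apply; exists s. Qed.

(** For c >= 0 the parameter of al(gamma s) exceeds c exactly when al(gamma s) is off the arc
    gamma([0, c]), an open condition on s. *)
Let measurable_h : measurable_fun (period_set L) h.
Proof.
move=> mP; apply: (measurability _ (RGenOInfty.measurableE R)) => //.
move=> _ [_ [c ->] <-].
have [c0|c0] := ltP c 0.
  rewrite (_ : _ `&` _ = period_set L)//; apply/seteqP; split => [s []//|s Ls].
  split => //=; rewrite in_itv/= andbT; have [/andP[h0 _] _] := hP s.
  exact: lt_le_trans h0.
rewrite (_ : _ `&` _ = period_set L `&`
   [set s | forall x, 0 <= x <= c -> al (gamma s) != gamma x]).
  apply: measurableI => //; apply: open_measurable; rewrite openE => s /= hs.
  have [e e0 he] := off_arc_open _ _ _ _ (cont_on_rcont _ (C1_on_cont _ C1al)) hs.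
  by apply/nbhs_ballP; exists e => //= t; rewrite /ball/= distrC => /he.
apply/seteqP; split => s [Ls hs]; split => //; move: hs => /=; rewrite in_itv/= andbT;
  have [/andP[h0 hL] gh] := hP s.
  move=> ch x /andP[x0 xc]; apply/negP => /eqP e.
  have : h s = x; last by move=> hx; move: ch; rewrite hx ltNge xc.
  apply: gamma_inj; [exact/andP| |by rewrite gh].
  by rewrite /period_set/= x0 (le_lt_trans xc (lt_trans ch hL)).
move=> off; rewrite ltNge; apply/negP => hc.
by have /eqP := off (h s) (introT andP (conj h0 hc)); rewrite gh.
Qed.

Lemma meas_on_comp (f : R[i] -> R) : meas_on L gamma f -> meas_on L gamma (f \o al).
Proof.
move=> mf; apply: (@eq_measurable_fun _ _ _ _ _ ((f \o gamma) \o h)).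
  by move=> s _ /=; have [_ ->] := hP s.
apply: (@measurable_comp _ _ _ _ _ _ (period_set L)) => //.
- exact: measurable_period_set.
- by move=> _ [s _ <-]; have [] := hP s.
Qed.

(** In the parameter, al is locally expanding because its inverse is Lipschitz: |x - y| <= 2 |gamma
    x - gamma y| = 2 |be(gamma(h x)) - be(gamma(h y))| <= 2 K |h x - h y|. The first inequality is
    only local, so the constants add up over the pieces of a chain. *)
Lemma measure_preimage_le : exists2 C : R, 0 <= C & forall E : set R, measurable E ->
  E `<=` period_set L ->
  (mu [set s | period_set L s /\ exists2 x, E x & gamma x = al (gamma s)]
     <= C%:E * mu E)%E
  /\ measurable [set s | period_set L s /\ exists2 x, E x & gamma x = al (gamma s)].
Proof.
have [K K0 HK] := C1_on_lipschitz _ C1be.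
have setE E : E `<=` period_set L ->
    [set s | period_set L s /\ exists2 x, E x & gamma x = al (gamma s)]
      = period_set L `&` h @^-1` E.
  move=> EL; apply/seteqP; split => s [Ls].
    move=> [x Ex gx]; split => //=; have [h1 h2] := hP s.
    by rewrite (_ : h s = x)//; apply: gamma_inj; [|exact: EL|rewrite h2].
  by move=> Eh; split => //; exists (h s) => //; have [] := hP s.
have mE E : measurable E -> measurable (period_set L `&` h @^-1` E).
  by move=> mE; apply: measurable_h => //; exact: measurable_period_set.
pose I (u v : R) := [set s : R | u <= s < v].
have key : exists2 C : R, 0 <= C & forall E, measurable E ->
    (mu (I 0%R L `&` (period_set L `&` h @^-1` E)) <= C%:E * mu E)%E.
  apply: (interval_chain (fun u v => exists2 C : R, 0 <= C & forall E, measurable E ->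
    (mu (I u v `&` (period_set L `&` h @^-1` E)) <= C%:E * mu E)%E)).
  - exact: ltW length_gt0.
  - move=> u v w uv vw [C1 C10 h1] [C2 C20 h2]; exists (C1 + C2); first exact: addr_ge0.
    move=> E mE'.
    have mI (p q : R) : measurable (I p q `&` (period_set L `&` h @^-1` E)).
      apply: measurableI; last exact: mE.
      rewrite (_ : I p q = `[p, q[%classic); first exact: measurable_itv.
      by apply/seteqP; split=> s /=; rewrite in_itv.
    apply: (@le_trans _ _ (mu ((I u v `&` (period_set L `&` h @^-1` E)) `|`
       (I v w `&` (period_set L `&` h @^-1` E))))).
      apply: le_measure; rewrite ?inE; [exact: mI|by apply: measurableU; exact: mI|].
      move=> s [/= /andP[us sw] hs]; have [sv|vs] := ltP s v; [left|right]; split => //=.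
        by rewrite /I/= us.
      by rewrite /I/= vs.
    apply: (le_trans (@measureU2 _ _ _ mu _ _ (mI _ _) (mI _ _))).
    by rewrite EFinD ge0_muleDl ?lee_fin//; apply: leeD; [exact: h1|exact: h2].
  - move=> p _; have [d d0 hd] := gamma_expanding p; exists d => // u v pu up pv vp.
    (* The inner 2 K is the expansion constant, the outer 2 is the loss in covering by centred
       intervals. *)
    exists (2 * (2 * K)); first by rewrite !mulr_ge0// ltW.
    move=> E mE'; apply: (@measure_preimage_expanding _ _ _ h).
    + by rewrite mulr_gt0.
    + apply: measurableI; last exact: mE.
      rewrite (_ : I u v = `[u, v[%classic); first exact: measurable_itv.
      by apply/seteqP; split=> s /=; rewrite in_itv.
    + by move=> s [_ []].
    + move=> x y [/= /andP[ux xv] _] [/= /andP[uy yv] _].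
      apply: (le_trans (hd x y _ _)).
      * by rewrite ltr_norml; apply/andP; split; lra.
      * by rewrite ltr_norml; apply/andP; split; lra.
      rewrite -mulrA ler_pM2l//.
      rewrite -[gamma x]alK; last by exists x.
      rewrite -[gamma y]alK; last by exists y.
      have [_ <-] := hP x; have [_ <-] := hP y; exact: HK.
have [C C0 HC] := key; exists C => // E mE' EL; rewrite setE//; split; last exact: mE.
have := HC E mE'; rewrite setIA (_ : _ `&` period_set L = period_set L)//.
exact: setIid.
Qed.

Lemma ae_on_comp P : ae_on L gamma P -> ae_on L gamma (P \o al).
Proof.
have [C C0 HC] := measure_preimage_le; move=> [B [mB B0 PB]].
have mBL : measurable (B `&` period_set L).
  by apply: measurableI => //; exact: measurable_period_set.
have [|h1 h2] := HC _ mBL; first exact: subIsetr.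
exists [set s | period_set L s /\ exists2 x, (B `&` period_set L) x & gamma x = al (gamma s)].
split => //.
  apply/eqP; rewrite eq_le measure_ge0 andbT (le_trans h1)//.
  rewrite (_ : mu _ = 0%E) ?mule0//.
  apply/eqP; rewrite eq_le measure_ge0 andbT -B0; apply: le_measure; rewrite ?inE//.
move=> s [Ls nP]; split => //; exists (h s); last by have [] := hP s.
by have [h3 h4] := hP s; split => //; apply: PB; split => //; rewrite h4.
Qed.

Lemma distribution_comp : exists2 C : R, 0 <= C & forall f y, meas_on L gamma f ->
  (Defs.distribution L gamma (f \o al) y <= C%:E * Defs.distribution L gamma f y)%E.
Proof.
have [C C0 HC] := measure_preimage_le; exists C => // f y mf; rewrite /Defs.distribution.
have mE : measurable (period_set L `&` [set s | y < f (gamma s)]).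
  have := mf measurable_period_set _ (measurable_itv `]y, +oo[).
  by congr (measurable _); apply/seteqP; split=> s [] Ls /=; rewrite in_itv/= andbT.
have [|h1 _] := HC _ mE; first exact: subIsetl.
apply: le_trans h1; rewrite le_eqVlt; apply/orP; left; apply/eqP; congr (mu _).
apply/seteqP; split => s [Ls].
  move=> /= ys; split => //; have [h1 h2] := hP s.
  by exists (h s) => //; split => //=; rewrite h2.
by move=> [x [_ /= yx] gx]; split => //=; rewrite -gx.
Qed.

End Substitution.

Lemma small_arc_gt0 f (t : R[i]) (e : R) : G t -> cont_on G f -> 0 < e -> f t = 0 ->
  exists2 d : R, 0 < d & forall s, Defs.coord L gamma t <= s < Defs.coord L gamma t + d ->
    nc (f (gamma s)) <= e.
Proof.
move=> Gt cf e0 ft; have [_ gt] := coord_curve t Gt.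
have [d d0 h] := cont_on_rcont _ cf (Defs.coord L gamma t) e e0.
exists d => // s /andP[s1 s2]; have := h s; rewrite /= gt ft subr0.
by move=> /(_ _)/ltW; apply; rewrite ger0_norm; lra.
Qed.

End Curve.

(** * Decreasing rearrangement and the dilation bound *)

Section Rearrangement.
Context {R : realType} {L : R} {gamma : R -> R[i]}.
Context {rho : (R[i] -> R) -> \bar R}.
Hypothesis L_gt0 : 0 < L.
Hypothesis coordK : forall s, period_set L s -> Defs.coord L gamma (gamma s) = s.
Local Notation mu := (@lebesgue_measure R).
Local Notation dist := (Defs.distribution L gamma).
Implicit Types f g : R[i] -> R.

Lemma measure_period_set : mu (period_set L) = L%:E.
Proof.
rewrite (_ : period_set L = `[0, L[%classic); last first.
  by apply/seteqP; split=> s /=; rewrite in_itv.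
by rewrite lebesgue_measure_itv/= lte_fin L_gt0 sube0.
Qed.

Lemma measurable_superlevel f y : meas_on L gamma f ->
  measurable (period_set L `&` [set s | y < f (gamma s)]).
Proof.
move=> mf; have := mf measurable_period_set _ (measurable_itv `]y, +oo[).
by congr (measurable _); apply/seteqP; split=> s [] Ls /=; rewrite in_itv/= andbT.
Qed.

Lemma distribution_le_length f y : meas_on L gamma f -> (dist f y <= L%:E)%E.
Proof.
move=> mf; rewrite -measure_period_set; apply: le_measure; rewrite ?inE.
- exact: measurable_superlevel.
- exact: measurable_period_set.
- exact: subIsetl.
Qed.

Lemma distribution_fin f y : meas_on L gamma f -> dist f y = (fine (dist f y))%:E.
Proof.
move=> mf; rewrite fineK// ge0_fin_numE ?measure_ge0//.
exact: le_lt_trans (distribution_le_length _ y mf) (ltry _).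
Qed.

Lemma distribution_nonincreasing f x y : meas_on L gamma f -> x <= y ->
  (dist f y <= dist f x)%E.
Proof.
move=> mf xy; apply: le_measure; rewrite ?inE; try exact: measurable_superlevel.
by move=> s [Ls /= ys]; split => //=; exact: le_lt_trans ys.
Qed.

Lemma distribution_right_continuous f (s y : R) : meas_on L gamma f ->
  (s%:E < dist f y)%E -> exists2 y', y < y' & (s%:E < dist f y')%E.
Proof.
move=> mf sy; apply: contrapT => no.
pose F n := period_set L `&` [set s | y + n.+1%:R^-1 < f (gamma s)].
have mF n : measurable (F n) by exact: measurable_superlevel.
have FU : \bigcup_n F n = period_set L `&` [set s | y < f (gamma s)].
  apply/seteqP; split => t.
    by move=> [n _ [Lt /= h]]; split => //=; rewrite (lt_trans _ h)// ltrDl invr_gt0.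
  move=> [Lt /= yt]; have e0 : 0 < f (gamma t) - y by rewrite subr_gt0.
  by have [n hn] := ltr_add_invr yt; exists n.
have ndF : nondecreasing_seq F.
  move=> m n mn; apply/subsetPset => t [Lt /= h]; split => //=.
  by rewrite (le_lt_trans _ h)// lerD2l lef_pV2 ?posrE// ler_nat.
have := nondecreasing_cvg_mu (mu:=mu) mF _ ndF; rewrite FU.
move=> /(_ (measurable_superlevel _ _ mf)) cvF; have h := cvge_le _ cvF.
suff : (dist f y <= s%:E)%E by rewrite leNgt sy.
apply: h; apply: nearW => n /=; rewrite leNgt; apply/negP => sn.
by apply: no; exists (y + n.+1%:R^-1) => //; rewrite ltrDl invr_gt0.
Qed.

Lemma distribution_small f (s : R) : meas_on L gamma f -> 0 < s ->
  exists y, (dist f y < s%:E)%E.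
Proof.
move=> mf s0; apply: contrapT => no.
pose F n := period_set L `&` [set s | n%:R < f (gamma s)].
have mF n : measurable (F n) by exact: measurable_superlevel.
have F0 : \bigcap_n F n = set0.
  apply/seteqP; split => // t Ft.
  have := archi_boundP (normr_ge0 (f (gamma t))).
  have [_ /= h] := Ft (Num.bound `|f (gamma t)|) I.
  by move=> h'; have := lt_trans h' h; rewrite ltNge ler_norm.
have niF : nonincreasing_seq F.
  move=> m n mn; apply/subsetPset => t [Lt /= h]; split => //=.
  by rewrite (le_lt_trans _ h)// ler_nat.
have F0lt : (mu (F 0%N) < +oo)%E.
  exact: le_lt_trans (distribution_le_length _ _ mf) (ltry _).
have := nonincreasing_cvg_mu F0lt mF _ niF; rewrite F0 measure0 => /(_ measurable0).
move=> cvF; have h := cvge_ge _ cvF.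
suff : (s%:E <= 0)%E by rewrite lee_fin leNgt s0.
apply: h; apply: nearW => n /=; rewrite leNgt; apply/negP => sn.
by apply: no; exists n%:R.
Qed.

(** The decreasing rearrangement of f on ]0, L[. For s <= 0, where the levels may be unbounded, the
    condition [0 < s] empties the set, and [sup] takes its default value 0. *)
Definition rearrangement f (s : R) : R :=
  sup [set y | [/\ 0 <= y, 0 < s & (s%:E < dist f y)%E]].

Lemma rearrangement_ge0 f s : 0 <= rearrangement f s.
Proof.
rewrite /rearrangement; set S := [set _ | _].
have [[[y Sy] [M HM]]|/sup_out ->//] := pselect (has_sup S).
apply: (@le_trans _ _ y); first by case: Sy.
by apply: ub_le_sup => //; exists M.
Qed.

Lemma rearrangement_nonpos f s : s <= 0 -> rearrangement f s = 0.
Proof.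
move=> s0; rewrite /rearrangement (_ : [set _ | _] = set0) ?sup0//.
by apply/seteqP; split => // y [_]; rewrite ltNge s0.
Qed.

(** This duality carries all later facts on rearrangements. Right continuity of the distribution
    function makes the inequality on the left strict, and its decay at infinity keeps the set of
    levels bounded. *)
Lemma rearrangement_gt f (s y : R) : meas_on L gamma f -> 0 < s -> 0 <= y ->
  (y < rearrangement f s) = (s%:E < dist f y)%E.
Proof.
move=> mf s0 y0; apply/idP/idP => [|sy].
  rewrite /rearrangement; set S := [set _ | _] => yS.
  have S0 : S !=set0.
    by apply/set0P; apply: contraTneq yS => ->; rewrite sup0 ltNge y0.
  have [z [_ _ sz] yz] := sup_gt S0 yS.
  by apply: lt_le_trans sz _; apply: distribution_nonincreasing => //; exact: ltW.
have [y' yy' sy'] := distribution_right_continuous _ _ _ mf sy.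
apply: (lt_le_trans yy'); apply: ub_le_sup; last first.
  by split => //; rewrite (le_trans y0)// ltW.
have [M HM] := distribution_small _ _ mf s0; exists M => z [z0 _ sz].
rewrite leNgt; apply/negP => Mz.
have := distribution_nonincreasing _ _ _ mf (ltW Mz).
by rewrite leNgt (lt_trans HM).
Qed.

Lemma rearrangement_superlevel f y : meas_on L gamma f -> 0 <= y ->
  period_set L `&` [set s | y < rearrangement f s] = `]0, fine (dist f y)[%classic.
Proof.
move=> mf y0; apply/seteqP; split => s; rewrite /= in_itv/=.
  move=> [/andP[s0 sL]]; rewrite le_eqVlt in s0; case/predU1P: s0 => [<-|s0].
    by rewrite rearrangement_nonpos// ltNge y0.
  by rewrite rearrangement_gt// s0 distribution_fin// lte_fin.
move=> /andP[s0 sd]; split; last by rewrite rearrangement_gt// distribution_fin// lte_fin.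
rewrite /period_set/= (ltW s0) (lt_le_trans sd)// -lee_fin -distribution_fin//.
exact: distribution_le_length.
Qed.

Lemma measurable_rearrangement f : meas_on L gamma f ->
  measurable_fun (period_set L) (rearrangement f).
Proof.
move=> mf mP; apply: (measurability _ (RGenOInfty.measurableE R)) => //.
move=> _ [_ [c ->] <-].
have [c0|c0] := ltP c 0.
  rewrite (_ : _ `&` _ = period_set L)//; apply/seteqP; split => [s []//|s Ls].
  split => //=; rewrite in_itv/= andbT; exact: lt_le_trans (rearrangement_ge0 _ _).
rewrite (_ : _ `&` _ = period_set L `&` [set s | c < rearrangement f s]).
  by rewrite rearrangement_superlevel//; exact: measurable_itv.
by apply/seteqP; split=> s [] Ls /=; rewrite in_itv/= andbT.
Qed.

Lemma mfun_on_coord (g : R -> R) : measurable_fun (period_set L) g ->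
  (forall s, 0 <= g s) -> mfun_on L gamma (fun z => g (Defs.coord L gamma z)).
Proof.
move=> mg g0; split; last by move=> z; exact: g0.
apply: (@eq_measurable_fun _ _ _ _ _ g) => // s; rewrite inE => Ls /=.
by rewrite coordK.
Qed.

Lemma distribution_rearrangement f y : meas_on L gamma f -> 0 <= y ->
  dist (fun z => rearrangement f (Defs.coord L gamma z)) y = dist f y.
Proof.
move=> mf y0; rewrite {1}/Defs.distribution.
rewrite (_ : _ `&` _ = period_set L `&` [set s | y < rearrangement f s]); last first.
  by apply/seteqP; split=> s [] Ls /=; rewrite coordK.
rewrite rearrangement_superlevel// lebesgue_measure_itv/= lte_fin.
case: ltP => [d0|d0]; first by rewrite sube0 -distribution_fin.
by apply/eqP; rewrite eq_le measure_ge0/= distribution_fin// lee_fin.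
Qed.

Hypothesis bfn : banach_function_norm L gamma rho.
Hypothesis ri : rearrangement_invariant L gamma rho.
Hypothesis boyd_gt0 : 0 < boyd_upper L gamma rho.

Lemma rho_rearrangement f : mfun_on L gamma f ->
  rho (fun z => rearrangement f (Defs.coord L gamma z)) = rho f.
Proof.
move=> mf; have [mf' _] := mf; apply: ri => //.
  apply: mfun_on_coord; first exact: measurable_rearrangement.
  by move=> s; exact: rearrangement_ge0.
by move=> y y0; rewrite distribution_rearrangement.
Qed.

(** Default values are decisive here. A divergent [lim] would be 0, so the positive index is a
    genuine limit and the quotients are eventually positive; an infinite [boyd_h] would have [fine]
    equal to 0, whose [ln] is 0, giving the quotient 0. *)
Lemma boyd_h_fin_num (C : R) : exists2 t, C <= t & boyd_h L gamma rho t \is a fin_num.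
Proof.
move: boyd_gt0; rewrite /boyd_upper; set F := fun t => _ / _.
have [cF|/dvgP ->] := pselect (cvg (F x @[x --> +oo])); last by rewrite ltxx.
move=> l0; have nF : \forall x \near +oo, 0 < F x by apply: cvgr_gt cF _ l0.
have nC : \forall x \near +oo, C <= x by exact: nbhs_pinfty_ge (num_real C).
have [t [tF tC]] := filter_ex (filterI nF nC).
exists t => //; move: tF; rewrite /F.
by case: (boyd_h _ _ _ t) => [r//||] /=; rewrite ln0// mul0r ltxx.
Qed.

(** For t >= C the hypothesis says that the rearrangement of g at s is at most that of f at s/t,
    which is a dilation with norm bounded by the Boyd function at t. *)
Lemma rho_dominated_distribution (C : R) : exists2 K : R, 0 <= K &
  forall f g, mfun_on L gamma f -> mfun_on L gamma g ->
    (forall y, 0 <= y -> (dist g y <= C%:E * dist f y)%E) ->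
    (rho g <= K%:E * rho f)%E.
Proof.
(* With t >= 1 the point s/t remains in the period, so that the dilation is never cut off to 0
   there. *)
have [t tC hfin] := boyd_h_fin_num (Num.max C 1).
have [Ct t1] : C <= t /\ 1 <= t by apply/andP; rewrite -ge_max.
have t0 : 0 < t by exact: lt_le_trans t1.
set H := fine (boyd_h L gamma rho t).
have HE : boyd_h L gamma rho t = H%:E by rewrite fineK.
have PK s : period_set L s -> period_set L (s * t^-1).
  move=> /andP[s0 sL]; rewrite /period_set/= divr_ge0 ?(ltW t0)//=.
  rewrite ltr_pdivrMr// (lt_le_trans sL)// -{1}[L]mulr1 ler_pM2l//.
(* The 1 makes the constant positive, so that its product with an infinite norm of f is infinite and
   not 0. *)
exists (`|H| + 1) => [|f g mf mg fg]; first by rewrite addr_ge0.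
have [mf' _] := mf; have [mg' _] := mg.
pose F := rearrangement f.
have mF : measurable_fun (period_set L) F by exact: measurable_rearrangement.
have F0 s : 0 <= F s by exact: rearrangement_ge0.
have mdil (u : R -> R) : measurable_fun (period_set L) u ->
    measurable_fun (period_set L) (dilation L t^-1 u).
  move=> mu'; apply: (@eq_measurable_fun _ _ _ _ _ (u \o (fun s => s * t^-1))).
    by move=> s; rewrite inE => /PK /andP[_ h]; rewrite /dilation /= h.
  apply: (@measurable_comp _ _ _ _ _ _ (period_set L)) => //.
  - exact: measurable_period_set.
  - by move=> _ [s Ls <-]; exact: PK.
  - by apply: measurable_funM => //; exact: measurable_cst.
have dil0 (u : R -> R) : (forall s, 0 <= u s) -> forall s, 0 <= dilation L t^-1 u s.
  by move=> u0 s; rewrite /dilation; case: ifP.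
pose D := rho_bar L gamma rho (dilation L t^-1 F).
have mD := mfun_on_coord _ (mdil _ mF) (dil0 _ F0).
have gD : (rho g <= D)%E.
  rewrite -rho_rearrangement//; apply: (le_rho bfn) => //.
    apply: mfun_on_coord; first exact: measurable_rearrangement.
    by move=> s; exact: rearrangement_ge0.
  apply: ae_on_all => s Ls; rewrite coordK// /dilation; have := Ls.
  move=> /PK /andP[_ ->]; have /andP[+ _] := Ls; rewrite le_eqVlt.
  case/predU1P => [<-|s0]; first by rewrite mul0r /F !rearrangement_nonpos.
  rewrite leNgt; apply/negP; rewrite rearrangement_gt// => sg.
  have : (s%:E < t%:E * dist f (F (s / t)%R))%E.
    apply: lt_le_trans sg (le_trans (fg _ (F0 _)) _).
    by apply: lee_wpmul2r => //; rewrite ?lee_fin// measure_ge0.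
  rewrite distribution_fin// -EFinM lte_fin mulrC -ltr_pdivrMr// -lte_fin.
  by rewrite -distribution_fin// -rearrangement_gt ?divr_gt0// ltxx.
apply: le_trans gD _.
have key (c : R) : 0 <= c -> (c%:E * rho f <= 1)%E -> (c%:E * D <= H%:E)%E.
  move=> c0 cf; rewrite -HE /D /rho_bar -(rhoZ bfn)//.
  apply: ereal_sup_ubound; exists (fun s => c * F s).
    split.
    - by apply: measurable_funM => //; exact: measurable_cst.
    - by move=> s; rewrite mulr_ge0.
    - rewrite /rho_bar (rhoZ bfn)//; last exact: mfun_on_coord.
      by rewrite rho_rearrangement.
  rewrite /rho_bar; congr rho; apply/funext => z; rewrite /dilation.
  by case: ifP => // _; rewrite mulr0.
have D0 : (0 <= D)%E by exact: (rho_ge0 bfn).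
have H0 : 0 <= H.
  have := key 0 (lexx _); rewrite !mul0e => h.
  by rewrite -lee_fin; apply: h; exact: lee01.
have rf0 := rho_ge0 bfn _ mf; rewrite (ger0_norm H0).
case: (rho f) rf0 key => [r| |//] r0 key; last by rewrite gt0_muley ?leey// lte_fin ltr_wpDl.
rewrite lee_fin in r0; move: r0; rewrite le_eqVlt => /predU1P[r0|r0].
  (* If f has norm 0, all its multiples lie in the unit ball; all multiples of [D] are then bounded
     by [H], which forces [D] to vanish. *)
  rewrite -r0 mule0.
  have {}key c : 0 <= c -> (c%:E * D <= H%:E)%E.
    by move=> c0; apply: key => //; rewrite -r0 mule0 lee01.
  have := key 1 ler01; rewrite mul1e; case: D D0 key => [d| |//] d0 key // _.
  rewrite lee_fin leNgt; apply/negP => dgt0.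
  have := key ((H + 1) / d) (divr_ge0 (addr_ge0 H0 ler01) (ltW dgt0)).
  by rewrite -EFinM divfK ?gt_eqF// lee_fin gerDl ler10.
have := key r^-1; rewrite invr_ge0 (ltW r0) -EFinM mulVf ?gt_eqF// lexx.
move=> /(_ isT isT); rewrite lee_pdivrMl// => /le_trans; apply.
by rewrite -!EFinM lee_fin mulrC ler_pM2r// lerDl.
Qed.

End Rearrangement.

(** * Unimodular solutions of w (u o alpha) = u *)

Section Gauge.
Context {R : realType} {L : R} {gamma : R -> R[i]}.
Hypothesis Jordan : smooth_jordan_curve L gamma.
Variables al be : R[i] -> R[i].
Local Notation G := (curve gamma).
Hypotheses (C1al : C1_on G al) (C1be : C1_on G be).
Hypothesis alK : forall t, G t -> be (al t) = t.
Hypothesis beK : forall t, G t -> al (be t) = t.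
Local Notation nc := (@ComplexField.Normc.normc R).
Local Notation mu := (@lebesgue_measure R).
Let L_gt0 : 0 < L := length_gt0 Jordan.

Lemma measC_on_index (I : countType) (idx : R -> I) (v : I -> R[i]) (u : R[i] -> R[i]) :
  (forall s, period_set L s -> u (gamma s) = v (idx s)) ->
  (forall k, measurable [set s | idx s = k]) -> measC_on L gamma u.
Proof.
move=> uv midx.
have H (p : R[i] -> R) : measurable_fun (period_set L) (fun s => p (u (gamma s))).
  move=> mP B mB; rewrite (_ : _ `&` _ = period_set L `&`
      \bigcup_k ([set s | idx s = k] `&` [set s | B (p (v k))])).
    apply: measurableI => //; apply: countable_bigcupT_measurable => [|k].
      exact: countableP.
    apply: measurableI => //; have [Bk|Bk] := pselect (B (p (v k))).
      rewrite (_ : [set _ | _] = setT); first exact: measurableT.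
      by apply/seteqP; split.
    rewrite (_ : [set _ | _] = set0); first exact: measurable0.
    by apply/seteqP; split.
  apply/seteqP; split => s [Ls] /=; rewrite uv//.
    by move=> Bs; split => //; exists (idx s).
  by move=> [k _ [/= <-]].
by split; exact: H.
Qed.

Lemma alpha_inj x y : al (gamma x) = al (gamma y) -> gamma x = gamma y.
Proof.
move=> e; rewrite -[LHS]alK; last by exists x.
by rewrite e alK//; exists y.
Qed.

(** * Lifting alpha to the line *)

Section Lift.

Let s1 : R := Defs.coord L gamma (al (gamma 0)).

(** The parameter of al(gamma s) chosen in the window ]s1, s1 + L[. For 0 < s < L the point al(gamma
    s) differs from al(gamma 0), so it never meets the ends of the window and no jump occurs. *)
Let k (s : R) : R := let c := Defs.coord L gamma (al (gamma s)) in
  if s1 < c then c else c + L.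

Let alG z : G z -> G (al z).
Proof. by case: C1al => + _; exact. Qed.

Let s1P : period_set L s1 /\ gamma s1 = al (gamma 0).
Proof. by apply: (coord_curve Jordan); apply: alG; exists 0. Qed.

Let kP s : 0 < s < L -> s1 < k s < s1 + L /\ gamma (k s) = al (gamma s).
Proof.
move=> /andP[s0 sL]; rewrite /k.
have [/andP[c0 cL] gc] : period_set L (Defs.coord L gamma (al (gamma s))) /\
    gamma (Defs.coord L gamma (al (gamma s))) = al (gamma s).
  by apply: (coord_curve Jordan); apply: alG; exists s.
move: c0 cL gc; set c := Defs.coord _ _ _ => c0 cL gc.
have [/andP[s10 s1L] gs1] := s1P.
have [cs|cs|cs] := ltgtP s1 c.
- by split => //; apply/andP; split; lra.
- split; first by apply/andP; split; lra.
  by rewrite -gc -[L]mul1r -[1]/(1%:~R); exact: (gamma_period Jordan).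
- have : gamma s = gamma 0 by apply: alpha_inj; rewrite -gc -gs1 cs.
  move=> /(gamma_eq_lt Jordan); rewrite subr0 gtr0_norm// => /(_ sL) e.
  by rewrite e ltxx in s0.
Qed.

Let shift_reduce x (q : int) : reduce (L:=L) (x + q%:~R * L) = reduce (L:=L) x /\
  Num.floor ((x + q%:~R * L) / L) = Num.floor (x / L) + q.
Proof.
have e : Num.floor ((x + q%:~R * L) / L) = Num.floor (x / L) + q.
  by rewrite mulrDl mulfK ?gt_eqF// floorDrz ?intr_int// intrKfloor.
by split => //; rewrite /reduce e intrD; ring.
Qed.

Let reduceE x : x = reduce (L:=L) x + (Num.floor (x / L))%:~R * L.
Proof. by rewrite /reduce subrK. Qed.

(** For t near s the point al(gamma t) avoids the two arcs of the window at distance at least e to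
    the left and right of k(s), which leaves for k(t) only the e-neighbourhood of k(s). *)
Let k_continuous : {within [set` `]0, L[], continuous k}.
Proof.
have cF := cont_on_rcont Jordan _ (C1_on_cont _ C1al).
rewrite continuous_open_subspace; last exact: interval_open.
move=> s; rewrite inE/= in_itv/= => s0L; have [/andP[k1 k2] gk] := kP s s0L.
apply/cvgrPdist_lt => e e0.
have [d1 d10 hd1] : exists2 d, 0 < d & forall t, `|t - s| < d ->
    forall x, s1 <= x <= Num.max s1 (k s - e) -> (al \o gamma) t != gamma x.
  apply: (off_arc_open Jordan) => // x /andP[x1]; rewrite le_max => x2.
  apply/eqP => /= e1; have xk : x < k s by case/orP: x2 => ?; lra.
  have /(gamma_eq_lt Jordan) : gamma (k s) = gamma x by rewrite gk.
  by rewrite ger0_norm ?subr_ge0 ?(ltW xk)// => h; move: xk; rewrite -h ?ltxx//; lra.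
have [d2 d20 hd2] : exists2 d, 0 < d & forall t, `|t - s| < d ->
    forall x, Num.min (s1 + L) (k s + e) <= x <= s1 + L -> (al \o gamma) t != gamma x.
  apply: (off_arc_open Jordan) => // x /andP[]; rewrite ge_min => x2 x1.
  apply/eqP => /= e1; have xk : k s < x by case/orP: x2 => ?; lra.
  have /(gamma_eq_lt Jordan) : gamma x = gamma (k s) by rewrite gk.
  by rewrite ger0_norm ?subr_ge0 ?(ltW xk)// => h; move: xk; rewrite h ?ltxx//; lra.
have /andP[s0 sL] := s0L.
apply/nbhs_ballP; exists (Num.min (Num.min d1 d2) (Num.min s (L - s))) => /=.
  by rewrite !lt_min d10 d20 s0 subr_gt0.
move=> t; rewrite /ball/= distrC !lt_min => /andP[/andP[t1 t2] /andP[t3 t4]].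
have t0L : 0 < t < L.
  by move: t3 t4; rewrite !ltr_norml => /andP[? ?] /andP[? ?]; apply/andP; split; lra.
have [/andP[kt1 kt2] gkt] := kP t t0L.
rewrite ltr_norml; apply/andP; split.
  rewrite ltrNl opprB ltNge; apply/negP => h.
  have := hd2 _ t2 (k t); rewrite /= gkt eqxx => h'; suff : false by [].
  by apply: h'; rewrite ge_min (ltW kt2) andbT; apply/orP; right; lra.
rewrite ltNge; apply/negP => h.
have := hd1 _ t1 (k t); rewrite /= gkt eqxx => h'; suff : false by [].
by apply: h'; rewrite le_max (ltW kt1) /=; apply/orP; right; lra.
Qed.

Let k_injective : {in `]0, L[ &, injective k}.
Proof.
move=> x y; rewrite !in_itv/= => /[dup] /kP[_ gx] /andP[? ?] /[dup] /kP[_ gy] /andP[? ?] e.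
apply: (gamma_eq_lt Jordan); first by apply: alpha_inj; rewrite -gx -gy e.
by rewrite ltr_norml; apply/andP; split; lra.
Qed.

Lemma lift_increasing : {in `]0, L[ &, {homo k : x y / x < y}} ->
  preserves_orientation gamma al.
Proof.
move=> kinc.
(* An increasing branch starts at the left end of the window; adding L per period then extends it
   monotonically to the line. *)
pose g r := if r == 0 then s1 else k r.
have gP r : period_set L r -> s1 <= g r < s1 + L /\ gamma (g r) = al (gamma r).
  move=> /andP[r0 rL]; rewrite /g; case: eqVneq => [->|rn0].
    by rewrite lexx ltrDl; split => //; case: s1P.
  have [|/andP[h1 h2] h3] := kP r; first by rewrite lt0r rn0 r0.
  by rewrite h2 (ltW h1).
have ginc r r' : period_set L r -> period_set L r' -> r < r' -> g r < g r'.
  move=> /andP[r0 rL] /andP[r0' rL'] rr'; rewrite /g (gt_eqF (le_lt_trans r0 rr')).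
  have r'0 := le_lt_trans r0 rr'.
  case: eqVneq => [_|rn0].
    by have [|/andP[]] := kP r'; rewrite ?r'0.
  by apply: kinc => //; rewrite in_itv/= ?r'0// lt0r rn0 r0.
pose h x := g (reduce (L:=L) x) + (Num.floor (x / L))%:~R * L.
have hg x : al (gamma x) = gamma (h x).
  rewrite /h (gamma_period Jordan); have [_ ->] := gP _ (reduce_period Jordan x).
  by rewrite (gamma_reduce Jordan).
have hinc x y : x < y -> h x < h y.
  move=> xy; rewrite /h.
  have le : Num.floor (x / L) <= Num.floor (y / L).
    by apply: le_floor; rewrite ler_pM2r ?invr_gt0// ltW.
  have [/andP[x1 x2] _] := gP _ (reduce_period Jordan x).
  have [/andP[y1 y2] _] := gP _ (reduce_period Jordan y).
  move: le; rewrite le_eqVlt => /predU1P[e|lt].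
    rewrite e ltrD2r; apply: ginc; try exact: (reduce_period Jordan).
    by move: xy; rewrite [x in x < _]reduceE [y in _ < y]reduceE e ltrD2r.
  have : (Num.floor (x / L) + 1)%:~R * L <= (Num.floor (y / L))%:~R * L.
    by rewrite ler_pM2r// ler_int lezD1.
  rewrite intrD mulrDl mul1r; lra.
(* Surjectivity comes from the inverse diffeomorphism, and a strictly increasing surjection is
   continuous, so the junctions of periods need no separate study. *)
have hsurj y : exists x, h x = y.
  have [r _ er] : G (be (gamma y)) by case: C1be => + _; apply; exists y.
  have : gamma (h r) = gamma y by rewrite -hg er beK//; exists y.
  move=> /(gamma_eq Jordan)[q hq]; exists (r + (- q)%:~R * L).
  have [e1 e2] := shift_reduce r (- q).
  by rewrite /h e1 e2 intrD mulrDl addrA -/(h r) hq mulrNz; ring.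
exists h; split; last by split.
move=> x; apply/cvgrPdist_lt => e e0.
have [x1 h1] := hsurj (h x - e); have [x2 h2] := hsurj (h x + e).
have lt1 : x1 < x.
  rewrite ltNge; apply/negP; rewrite le_eqVlt => /predU1P[ex|/hinc]; last by rewrite h1; lra.
  by move: h1; rewrite -ex; lra.
have lt2 : x < x2.
  rewrite ltNge; apply/negP; rewrite le_eqVlt => /predU1P[ex|/hinc]; last by rewrite h2; lra.
  by move: h2; rewrite ex; lra.
apply/nbhs_ballP; exists (Num.min (x - x1) (x2 - x)) => /=.
  by rewrite lt_min !subr_gt0 lt1.
move=> t; rewrite /ball/= lt_min !ltr_norml => /andP[/andP[_ a1] /andP[a2 _]].
have b1 : h x1 < h t by apply: hinc; lra.
have b2 : h t < h x2 by apply: hinc; lra.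
by apply/andP; split; lra.
Qed.

Lemma lift_decreasing : {in `]0, L[ &, {homo k : x y /~ x < y}} ->
  exists h : R -> R, [/\ forall x y, x < y -> h y < h x,
    forall x, al (gamma x) = gamma (h x)
    & forall x (q : int), h (x + q%:~R * L) = h x - q%:~R * L].
Proof.
move=> kdec.
(* A decreasing branch starts at the right end of the window and loses L per period. *)
pose g r := if r == 0 then s1 + L else k r.
have gP r : period_set L r -> s1 < g r <= s1 + L /\ gamma (g r) = al (gamma r).
  move=> /andP[r0 rL]; rewrite /g; case: eqVneq => [->|rn0].
    rewrite lexx ltrDl L_gt0 -[L]mul1r -[1]/(1%:~R) (gamma_period Jordan).
    by split => //; case: s1P.
  have [|/andP[h1 h2] h3] := kP r; first by rewrite lt0r rn0 r0.
  by rewrite h1 (ltW h2).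
have gdec r r' : period_set L r -> period_set L r' -> r < r' -> g r' < g r.
  move=> /andP[r0 rL] /andP[r0' rL'] rr'; rewrite /g (gt_eqF (le_lt_trans r0 rr')).
  have r'0 := le_lt_trans r0 rr'.
  case: eqVneq => [_|rn0].
    by have [|/andP[]] := kP r'; rewrite ?r'0.
  by apply: kdec => //; rewrite in_itv/= ?r'0// lt0r rn0 r0.
exists (fun x => g (reduce (L:=L) x) - (Num.floor (x / L))%:~R * L); split.
- move=> x y xy.
  have le : Num.floor (x / L) <= Num.floor (y / L).
    by apply: le_floor; rewrite ler_pM2r ?invr_gt0// ltW.
  have [/andP[x1 x2] _] := gP _ (reduce_period Jordan x).
  have [/andP[y1 y2] _] := gP _ (reduce_period Jordan y).
  move: le; rewrite le_eqVlt => /predU1P[e|lt].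
    rewrite e ltrD2r; apply: gdec; try exact: (reduce_period Jordan).
    by move: xy; rewrite [x in x < _]reduceE [y in _ < y]reduceE e ltrD2r.
  have : (Num.floor (x / L) + 1)%:~R * L <= (Num.floor (y / L))%:~R * L.
    by rewrite ler_pM2r// ler_int lezD1.
  rewrite intrD mulrDl mul1r; lra.
- move=> x; rewrite -mulNr -mulrNz (gamma_period Jordan).
  have [_ ->] := gP _ (reduce_period Jordan x).
  by rewrite (gamma_reduce Jordan).
- move=> x q; have [-> ->] := shift_reduce x q.
  by rewrite intrD; ring.
Qed.

(** A continuous injective function on an interval is monotone, and the increasing case would yield
    an orientation-preserving lift. *)
Lemma lift_reversing : ~ preserves_orientation gamma al ->
  exists h : R -> R, [/\ forall x y, x < y -> h y < h x,
    forall x, al (gamma x) = gamma (h x)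
    & forall x (q : int), h (x + q%:~R * L) = h x - q%:~R * L].
Proof.
move=> np; have [/lift_increasing//|/lift_decreasing//] :=
  itv_continuous_inj_mono k_continuous k_injective.
Qed.

End Lift.

(** * Gauge for orientation-preserving alpha *)

Section OrientationPreserving.
Variables (h : R -> R) (n : nat) (t0 : R[i]).
Local Notation m := n.+1.
Hypotheses (ch : continuous h) (ih : forall s t, s < t -> h s < h t).
Hypothesis alh : forall s, al (gamma s) = gamma (h s).
Hypotheses (Gt0 : G t0) (t0m : iter m al t0 = t0).
Hypothesis minm : forall j, (0 < j < m)%N -> forall t, G t -> iter j al t <> t.

Let orb k := iter k al t0.

Let Gorb k : G (orb k).
Proof. by elim: k => // k IH; case: C1al => + _; apply. Qed.

(* The last point of the orbit of index k met before x on the line. *)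
Let e (k : nat) (x : R) : R :=
  let c := Defs.coord L gamma (orb k) in c + (Num.floor ((x - c) / L))%:~R * L.

Let eP k x : [/\ e k x <= x, x < e k x + L & gamma (e k x) = orb k].
Proof.
rewrite /e; set c := Defs.coord _ _ _.
have /andP[h1 h2] := mem_rg1_floor ((x - c) / L).
rewrite /= ler_pdivlMr// in h1; rewrite /= ltr_pdivrMr// mulrDl mul1r in h2.
split; [by rewrite addrC -lerBrDr|by rewrite -addrA -ltrBlDl|].
by rewrite (gamma_period Jordan); have [] := coord_curve Jordan _ (Gorb k).
Qed.

Let e_uniq k x y : y <= x -> x < y + L -> gamma y = orb k -> y = e k x.
Proof.
have [h1 h2 h3] := eP k x => yx xy gy; apply: (gamma_eq_lt Jordan); first by rewrite gy.
by rewrite ltr_norml; apply/andP; split; lra.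
Qed.

Let e_homo k : {homo e k : x y / x <= y}.
Proof.
move=> x y xy; rewrite /e lerD2l ler_pM2r// ler_int.
by apply: le_floor; rewrite ler_pM2r ?invr_gt0// lerD2r.
Qed.

(** The orbit cuts the curve into m arcs, and the index of the starting point of an arc serves as
    its label. There are no ties in the maximum, because minimality of m makes the orbit points
    distinct. *)
Let idx (x : R) : 'I_m := [arg max_(k > ord0) e k x]%O.

Let idx_ge x (k : 'I_m) : e k x <= e (idx x) x.
Proof. by rewrite /idx; case: arg_maxP => // i _; exact. Qed.

Let orb_lt (j k : 'I_m) : (j < k)%N -> orb j <> orb k.
Proof.
move=> jk ejk; apply: (minm (k - j)%N _ (orb j) (Gorb _)).
  by rewrite subn_gt0 jk (leq_ltn_trans (leq_subr _ _)).
by rewrite /orb -iterD subnK ?(ltnW jk)//; exact/esym.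
Qed.

Let idx_uniq x (k : 'I_m) : (forall j : 'I_m, e j x <= e k x) -> idx x = k.
Proof.
move=> H; have ee : e (idx x) x = e k x by apply/eqP; rewrite eq_le H idx_ge.
have [_ _ g1] := eP (idx x) x; have [_ _ g2] := eP k x.
have oo : orb (idx x) = orb k by rewrite -g1 -g2 ee.
apply/val_inj/eqP; rewrite /= eqn_leq leqNgt andbC leqNgt.
by apply/andP; split; apply/negP => h'; apply: (orb_lt _ _ h'); rewrite oo.
Qed.

Let e_shift k x (q : int) : e k (x + q%:~R * L) = e k x + q%:~R * L.
Proof.
have [h1 h2 h3] := eP k x; apply/esym/e_uniq; [lra|lra|].
by rewrite (gamma_period Jordan).
Qed.

Let idx_shift x (q : int) : idx (x + q%:~R * L) = idx x.
Proof. by apply: idx_uniq => j; rewrite !e_shift lerD2r idx_ge. Qed.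

Let hW x y : x <= y -> h x <= h y.
Proof. by rewrite le_eqVlt => /predU1P[->//|/ih/ltW]. Qed.

(** Monotonicity places the image of [e k x] before h(x). Were it a full period or more behind, the
    intermediate value theorem would give a y in [e k x, x] with h(y) = h(e k x) + L, against
    injectivity of al on less than a period. The wrap-around of [ordS] is the periodicity of
    [t0]. *)
Let e_h (k : 'I_m) x : e (ordS k) (h x) = h (e k x).
Proof.
have [h1 h2 h3] := eP k x; apply/esym/e_uniq; first exact: hW.
  rewrite ltNge; apply/negP => hL.
  have [|y] := @IVT _ h (e k x) x (h (e k x) + L) h1 (continuous_subspaceT ch).
    by rewrite ge_min le_max hL lerDl (ltW L_gt0) orbT.
  rewrite in_itv/= => /andP[ey yx] hy.
  have gy : gamma y = gamma (e k x).
    apply: alpha_inj; rewrite !alh hy -[L]mul1r -[1]/(1%:~R).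
    exact: (gamma_period Jordan).
  have ye : y = e k x by apply: (gamma_eq_lt Jordan) => //; rewrite ger0_norm; lra.
  by move: hy; rewrite ye => /eqP; rewrite -subr_eq0 opprD addrA subrr sub0r oppr_eq0 gt_eqF.
rewrite -alh h3 /orb /= -iterS.
have [kn|kn] := ltnP k n; first by rewrite modn_small.
have -> : k = n :> nat by apply/eqP; rewrite eqn_leq kn -ltnS ltn_ord.
by rewrite modnn t0m.
Qed.

Let idx_h x : idx (h x) = ordS (idx x).
Proof.
apply: idx_uniq => j; rewrite -(ord_predK j) !e_h.
exact/hW/idx_ge.
Qed.

Let measurable_idx k : measurable [set x | idx x = k].
Proof.
rewrite (_ : [set _ | _] = \bigcap_(j in [set: 'I_m])
    ((e k \- e j) @^-1` `[0, +oo[%classic)).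
  apply: fin_bigcap_measurable; first exact: finite_finset.
  move=> j _; rewrite -[X in measurable X]setTI.
  have me i : measurable_fun setT (e i) by apply: nondecreasing_measurable => //; exact: e_homo.
  by apply: (measurable_funB (me k) (me j)).
apply/seteqP; split => x /=.
  by move=> <- j _ /=; rewrite in_itv/= andbT subr_ge0.
by move=> H; apply: idx_uniq => j; have := H j I; rewrite /= in_itv/= andbT subr_ge0.
Qed.

(** Since alpha raises the label of an arc by one modulo m, w^-1 to the power of the label is
    multiplied by w^-1; the wrap-around is harmless because w^m = 1. *)
Lemma gauge_preserving (w : R[i]) : w ^+ m = 1 -> exists u : R[i] -> R[i],
  [/\ measC_on L gamma u, ae_on L gamma (fun z => nc (u z) = 1)
    & ae_on L gamma (fun z => w * u (al z) = u z)].
Proof.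
move=> wm; pose v := w^-1.
have w0 : w != 0 by apply: contra_eq_neq wm => ->; rewrite expr0n eq_sym oner_eq0.
have vm : v ^+ m = 1 by rewrite exprVn wm invr1.
pose u z := v ^+ idx (Defs.coord L gamma z).
have uE x : u (gamma x) = v ^+ idx x.
  by rewrite /u; have [q ->] := coord_shift Jordan x; rewrite idx_shift.
exists u; split.
- by apply: (measC_on_index _ idx (fun k : 'I_m => v ^+ k)).
- by apply: ae_on_all => s _; rewrite ncX (root_of_unity_nc v m)// expr1n.
- apply: ae_on_all => s _; rewrite alh !uE idx_h /= expr_mod// exprS mulrA.
  by rewrite mulfV// mul1r.
Qed.

End OrientationPreserving.

(** * Gauge for orientation-changing alpha *)

Section OrientationReversing.
Variable H : R -> R.
Hypothesis dH : forall x y, x < y -> H y < H x.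
Hypothesis alH : forall x, al (gamma x) = gamma (H x).
Hypothesis H_shift : forall x (q : int), H (x + q%:~R * L) = H x - q%:~R * L.

Let D x := H x - x.
Let p x : int := Num.floor (D x / L).

Let D_decr x y : x < y -> D y < D x.
Proof. by move=> xy; rewrite /D ltrB// dH. Qed.

Let pP x : (p x)%:~R * L <= D x < (p x + 1)%:~R * L.
Proof.
have /andP[h1 h2] := mem_rg1_floor (D x / L).
by rewrite -ler_pdivlMr// h1 -ltr_pdivrMr// intrD.
Qed.

Let p_uniq x (q : int) : q%:~R * L <= D x < (q + 1)%:~R * L -> p x = q.
Proof.
by rewrite -ler_pdivlMr// -ltr_pdivrMr// => h; exact: floor_def.
Qed.

Let p_shift x (q : int) : p (x + q%:~R * L) = p x - q - q.
Proof.
have /andP[h1 h2] := pP x; apply: p_uniq.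
rewrite /D H_shift; rewrite !(intrD, intrB) in h1 h2 *.
by move: h1 h2; rewrite /D => h1 h2; apply/andP; split; lra.
Qed.

(** Off the fixed points, x + pL < H x < x + (p+1)L. Applying the decreasing H places the
    displacement of H x strictly between -(p+1)L and -pL, so the parity of [p] flips. *)
Let p_H x : D x != (p x)%:~R * L -> p (H x) = - (p x + 1).
Proof.
move=> ne; have /andP[h1 h2] := pP x.
have {h1 ne}h1 : (p x)%:~R * L < D x by rewrite lt_neqAle eq_sym ne.
have a1 : x + (p x)%:~R * L < H x by rewrite addrC -ltrBrDr.
have a2 : H x < x + (p x + 1)%:~R * L by rewrite addrC -ltrBlDr.
have b1 := dH _ _ a1; have b2 := dH _ _ a2; rewrite !H_shift in b1 b2.
apply: p_uniq; rewrite {1 2}/D; rewrite !(intrD, intrN, mulrNz) in b1 b2 *.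
by apply/andP; split; lra.
Qed.

(** A shift by q periods changes [p] by -2q, so w^p is well defined on the curve when w^2 = 1. The
    fixed points correspond to displacements that are multiples of L; since the displacement is
    strictly decreasing, each multiple is taken at most once and the exceptional set is
    countable. *)
Lemma gauge_reversing (w : R[i]) : w ^+ 2 = 1 -> exists u : R[i] -> R[i],
  [/\ measC_on L gamma u, ae_on L gamma (fun z => nc (u z) = 1)
    & ae_on L gamma (fun z => w * u (al z) = u z)].
Proof.
move=> w2.
have w0 : w != 0 by apply: contra_eq_neq w2 => ->; rewrite expr0n eq_sym oner_eq0.
have wz (q : int) : w ^ (q + q) = 1.
  by rewrite -mulr2n -mulr_natl -exprz_exp (_ : w ^ 2%:R = 1) ?exp1rz.
pose u z := w ^ p (Defs.coord L gamma z).
have uE x : u (gamma x) = w ^ p x.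
  rewrite /u; have [q ->] := coord_shift Jordan x; rewrite p_shift -addrA expfzDr//.
  by rewrite wz mulr1.
exists u; split.
- apply: (measC_on_index _ p (fun k : int => w ^ k)) => // k.
  rewrite (_ : [set _ | _] = D @^-1` `[k%:~R * L, (k + 1)%:~R * L[%classic).
    rewrite -[X in measurable X]setTI.
    have mD : measurable_fun setT D.
      apply: nonincreasing_measurable => // x y.
      by rewrite le_eqVlt => /predU1P[->//|/D_decr/ltW].
    by apply: mD => //; exact: measurable_itv.
  apply/seteqP; split => x /=; rewrite in_itv/=; first by move=> <-.
  exact: p_uniq.
- apply: ae_on_all => s _; have ncw := root_of_unity_nc w 2 isT w2.
  rewrite /u; case: (p _) => k; first by rewrite -exprnP ncX ncw expr1n.
  by rewrite NegzE -exprnN ncV ncX ncw expr1n invr1.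
- have cnt : countable [set x | exists q : int, D x = q%:~R * L].
    apply: (@sub_countable _ _ _ [set: int]) => //.
    apply: card_le_trans (card_image_le (fun q : int => xget 0 [set x | D x = q%:~R * L]) _).
    apply: subset_card_le => x [q Dx]; exists q => //.
    have : D (xget 0 [set x | D x = q%:~R * L]) = q%:~R * L.
      by apply: (@xgetPex _ 0 [set x | D x = q%:~R * L]); exists x.
    move: (xget _ _) => y Dy; rewrite -Dx in Dy.
    by case: (ltgtP y x) => // /D_decr; rewrite Dy ltxx.
  have N : mu.-negligible [set x | exists q : int, D x = q%:~R * L].
    by exists [set x | exists q : int, D x = q%:~R * L]; split => //;
      [exact: countable_measurable|exact: countable_lebesgue_measure0].
  apply: negligibleS N => s [Ls]; apply: contra_notP => no.
  rewrite alH !uE p_H; last by apply/negP => /eqP e; apply: no; exists (p s).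
  rewrite -{1}[w]expr1z -expfzDr// opprD addrCA subrr addr0.
  by rewrite -[LHS]mulr1 -(wz (p s)) -expfzDr// addrA addNr add0r.
Qed.

End OrientationReversing.
End Gauge.

(** * Algebra of continuous coefficients *)

Section ContinuousCoefficients.
Context {R : realType} {G : set R[i]}.
Local Notation nc := (@ComplexField.Normc.normc R).
Implicit Types f g : R[i] -> R[i].

Lemma cont_onD f g : cont_on G f -> cont_on G g -> cont_on G (fun z => f z + g z).
Proof.
move=> cf cg t Gt e e0; have e20 : 0 < e / 2 by rewrite divr_gt0.
have [d d0 h] := cf t Gt _ e20; have [d' d'0 h'] := cg t Gt _ e20.
exists (Num.min d d') => [|x Gx]; first by rewrite lt_min d0.
rewrite lt_min => /andP[/(h _ Gx) h1 /(h' _ Gx) h2].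
have -> : f x + g x - (f t + g t) = (f x - f t) + (g x - g t) by ring.
have := ncD (f x - f t) (g x - g t); lra.
Qed.

Lemma cont_onM f g : cont_on G f -> cont_on G g -> cont_on G (fun z => f z * g z).
Proof.
move=> cf cg t Gt e e0.
pose M := nc (f t) + nc (g t) + 1.
have M1 : 1 <= M by rewrite lerDr addr_ge0// nc_ge0.
have M0 : 0 < M by exact: lt_le_trans M1.
have e'0 : 0 < Num.min 1 (e / (2 * M)).
  by rewrite lt_min ltr01 divr_gt0// mulr_gt0.
have [d d0 h] := cf t Gt _ e'0; have [d' d'0 h'] := cg t Gt _ e'0.
exists (Num.min d d') => [|x Gx]; first by rewrite lt_min d0.
rewrite lt_min => /andP[/(h _ Gx)]; rewrite lt_min => /andP[_ h2].
move=> /(h' _ Gx); rewrite lt_min => /andP[h3 h4].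
have -> : f x * g x - f t * g t = (f x - f t) * g x + f t * (g x - g t) by ring.
apply: le_lt_trans (ncD _ _) _; rewrite !ncM.
have gx : nc (g x) <= M.
  rewrite -[X in nc X](subrK (g t)) (le_trans (ncD _ _))// /M.
  have := nc_ge0 (f t); lra.
have ft : nc (f t) <= M by rewrite /M; have := nc_ge0 (g t); lra.
have -> : e = e / (2 * M) * M + M * (e / (2 * M)).
  by field; rewrite gt_eqF.
apply: ltr_leD.
  apply: (le_lt_trans (ler_wpM2l (nc_ge0 _) gx)).
  by rewrite ltr_pM2r.
by rewrite ler_pM ?nc_ge0// ltW.
Qed.

Lemma cont_on_conj f : cont_on G f -> cont_on G (fun z => (f z)^*%C).
Proof.
move=> cf t Gt e e0; have [d d0 h] := cf t Gt e e0; exists d => // x Gx /(h _ Gx).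
by rewrite -rmorphB /= nc_conj.
Qed.

Lemma cont_onV f : cont_on G f -> (forall t, G t -> f t != 0) ->
  cont_on G (fun z => (f z)^-1).
Proof.
move=> cf f0 t Gt e e0; have n0 : 0 < nc (f t) by rewrite nc_gt0 f0.
have e'0 : 0 < Num.min (nc (f t) / 2) (e * nc (f t) ^+ 2 / 2).
  by rewrite lt_min !divr_gt0// mulr_gt0// exprn_gt0.
have [d d0 h] := cf t Gt _ e'0; exists d => // x Gx /(h _ Gx).
rewrite lt_min => /andP[h1 h2]; have fx0 := f0 _ Gx; have ft0 := f0 _ Gt.
have -> : (f x)^-1 - (f t)^-1 = (f t - f x) / (f x * f t).
  by field; rewrite fx0 ft0.
have nx : nc (f t) / 2 < nc (f x).
  have := ncD (f x) (f t - f x); rewrite addrC subrK ncC; lra.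
have nx0 : 0 < nc (f x) by rewrite nc_gt0.
rewrite ncM ncV ncM ltr_pdivrMr ?mulr_gt0// ncC.
apply: (lt_le_trans h2); rewrite expr2 -!mulrA ler_pM2l//.
by rewrite mulrC -mulrA (mulrC (nc (f x))) ler_pM2l// mulrC ltW// mulrC.
Qed.

End ContinuousCoefficients.

(** The root 1 is put first because a right inverse of a product yields one of its leftmost factor,
    which has to be the one conjugate to aI - bW. *)
Lemma XnsubC1_split (R : realType) (n : nat) : exists2 ws : seq R[i],
  {in ws, forall w, w ^+ n.+1 = 1} &
  \prod_(w <- 1 :: ws) ('X - w%:P) = 'X^(n.+1) - 1.
Proof.
have [ws Hws] := closed_field_poly_normal ('X^(n.+1) - 1 : {poly R[i]}).
have lc : lead_coef ('X^(n.+1) - 1 : {poly R[i]}) = 1.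
  by rewrite -[1]polyC1 lead_coefXnsubC.
rewrite lc scale1r in Hws.
have wsr w : (w \in ws) = (w ^+ n.+1 == 1).
  by rewrite -root_prod_XsubC -Hws rootE !hornerE subr_eq0.
have p1 := perm_to_rem (etrans (wsr 1) (introT eqP (expr1n _ _))).
exists (rem 1 ws); first by move=> w /mem_rem; rewrite wsr => /eqP.
by rewrite Hws (perm_big _ p1).
Qed.

(** * Right invertibility of A and of A_m *)

Section OneSidedInvertibility.
Context {R : realType} {L : R} {gamma : R -> R[i]} {rho : (R[i] -> R) -> \bar R}.
Hypothesis Jordan : smooth_jordan_curve L gamma.
Variables al be : R[i] -> R[i].
Local Notation G := (curve gamma).
Local Notation nc := (@ComplexField.Normc.normc R).
Local Notation mu := (@lebesgue_measure R).
Local Notation rinv := (right_invertible L gamma rho).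
Hypotheses (C1al : C1_on G al) (C1be : C1_on G be).
Hypothesis alK : forall t, G t -> be (al t) = t.
Hypothesis beK : forall t, G t -> al (be t) = t.
Hypothesis bfn : banach_function_norm L gamma rho.
Hypothesis ri : rearrangement_invariant L gamma rho.
Hypothesis boyd_gt0 : 0 < boyd_upper L gamma rho.

(** The Lipschitz bound of the inverse [g] controls measures of preimages under [f]; domination of
    distribution functions turns this into the norm bound. *)
Lemma C1_composable (f g : R[i] -> R[i]) : C1_on G f -> C1_on G g ->
  (forall t, G t -> g (f t) = t) -> composable (L:=L) (gamma:=gamma) (rho:=rho) f.
Proof.
move=> C1f C1g fK; split.
- by move=> h mh; exact: (meas_on_comp Jordan).
- by move=> P; exact: (ae_on_comp Jordan _ _ C1f C1g fK).
- have [C C0 HC] := distribution_comp Jordan _ _ C1f C1g fK.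
  have [K K0 HK] := rho_dominated_distribution (length_gt0 Jordan)
    (coord_gamma Jordan) bfn ri boyd_gt0 C.
  exists K => // h mh; have [mh' h0] := mh; apply: HK => //.
    by split; [exact: (meas_on_comp Jordan)|move=> z; exact: h0].
  by move=> y _; exact: HC.
Qed.

Let cal := C1_composable _ _ C1al C1be alK.
Let cbe := C1_composable _ _ C1be C1al beK.

Let alG z : G z -> G (al z).
Proof. by case: C1al => + _; exact. Qed.

Let iterG k z : G z -> G (iter k al z).
Proof. by move=> Gz; elim: k => // k IH; exact: alG. Qed.

Let cont_iter k f : cont_on G f -> cont_on G (f \o iter k al).
Proof.
move=> cf; apply: cont_on_comp => //; first by move=> z; exact: iterG.
elim: k => [|k IH]; first by move=> t _ e e0; exists e.
by apply: cont_on_comp IH => //; [move=> z; exact: iterG|exact: C1_on_cont].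
Qed.

Lemma right_invertible_coef_neq0 a b : cont_on G a -> cont_on G b ->
  rinv (opA a b al) -> forall t, G t -> 0 < nc (a t) + nc (b t).
Proof.
move=> ca cb rA t Gt; rewrite lt0r addr_ge0 ?nc_ge0// andbT.
apply/negP; rewrite paddr_eq0 ?nc_ge0// !nc_eq0 => /andP[/eqP at0 /eqP bt0].
have [e e0 H] := right_invertible_coef_far0 bfn cal _ _ (cont_on_coef Jordan _ ca)
  (cont_on_coef Jordan _ cb) rA.
have [d1 d10 h1] := small_arc_gt0 Jordan _ _ _ Gt ca e0 at0.
have [d2 d20 h2] := small_arc_gt0 Jordan _ _ _ Gt cb e0 bt0.
have [/andP[c0 cL] _] := coord_curve Jordan t Gt.
move: h1 h2 c0 cL; set c := Defs.coord _ _ _ => h1 h2 c0 cL.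
(* The arc extends only to the right of t and is cut at L, so that it stays within one period and
   has positive length even for t = gamma(0). *)
pose q := Num.min L (c + Num.min d1 d2).
have cq : c < q by rewrite /q lt_min cL ltrDl lt_min d10.
have qL : q <= L by rewrite /q ge_min lexx.
have q1 : q <= c + d1 by rewrite /q ge_min lerD2l ge_min lexx orbT.
have q2 : q <= c + d2 by rewrite /q ge_min lerD2l ge_min lexx !orbT.
have cqL s : c <= s < q -> period_set L s.
  by move=> /andP[cs sq]; rewrite /period_set/= (le_trans c0 cs) (lt_le_trans sq).
pose E := [set z | exists2 s, c <= s < q & gamma s = z].
have EE : period_set L `&` gamma @^-1` E = `[c, q[%classic.
  apply/seteqP; split => s /=; rewrite in_itv/=.
    move=> [Ls [s' s'q /(gamma_inj Jordan _ _ (cqL _ s'q) Ls) <-]] //.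
  by move=> csq; split; [exact: cqL|exists s].
apply: (H E).
- by rewrite /meas_set_on EE; exact: measurable_itv.
- move=> [B [mB B0 NB]].
  have : (mu `[c, q[%classic <= mu B)%E.
    apply: le_measure; [by rewrite inE; exact: measurable_itv|by rewrite inE|].
    move=> s; rewrite /= in_itv/= => csq; apply: NB; split; first exact: cqL.
    by apply; exists s.
  by rewrite B0 lebesgue_measure_itv/= lte_fin cq -EFinB lee_fin leNgt subr_gt0 cq.
- move=> _ [s /andP[cs sq] <-]; split.
    by apply: h1; rewrite cs (lt_le_trans sq).
  by apply: h2; rewrite cs (lt_le_trans sq).
Qed.

(** The Bezout coefficients are the conjugates of a and b divided by |a|^2 + |b|^2, which is nonzero
    on the curve by the preceding lemma. *)
Lemma right_invertible_cont_shift a b : cont_on G a -> cont_on G b ->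
  rinv (opA a b al) -> rinv (opA a (b \o al) al).
Proof.
move=> ca cb rA; have nz := right_invertible_coef_neq0 _ _ ca cb rA.
pose N z := a z * (a z)^*%C + b z * (b z)^*%C.
have N0 z : G z -> N z != 0.
  move=> /nz; apply: contraTneq; rewrite /N !mulc_conj -rmorphD /= => -[/eqP].
  rewrite paddr_eq0 ?sqr_ge0// !sqrf_eq0 => /andP[/eqP -> /eqP ->].
  by rewrite addr0 ltxx.
have cN : cont_on G (fun z => (N z)^-1).
  by apply: cont_onV => //; apply: cont_onD; apply: cont_onM => //; exact: cont_on_conj.
apply: (right_invertible_shift bfn cal _ _ (fun z => (a z)^*%C * (N z)^-1)
  (fun z => (b z)^*%C * (N z)^-1)) => //; try exact: (cont_on_coef Jordan).
- by apply: (cont_on_coef Jordan); apply: cont_onM => //; exact: cont_on_conj.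
- by apply: (cont_on_coef Jordan); apply: cont_onM => //; exact: cont_on_conj.
- by move=> s _; rewrite !mulrA -mulrDl -/(N _) mulfV// N0//; exists s.
Qed.

Variables a b : R[i] -> R[i].
Hypotheses (ca : cont_on G a) (cb : cont_on G b).

Lemma right_invertible_iter_shift j :
  rinv (opA a b al) -> rinv (opA a (b \o iter j al) al).
Proof.
move=> rA; elim: j => [//|j IH].
have -> : b \o iter j.+1 al = (b \o iter j al) \o al.
  by apply/funext => z; rewrite /= -iterSr.
by apply: right_invertible_cont_shift => //; exact: cont_iter.
Qed.

Lemma right_invertible_iter_conj c d k :
  rinv (opA c d al) <-> rinv (opA (c \o iter k al) (d \o iter k al) al).
Proof.
elim: k => [//|k IH]; apply: (iff_trans IH).
have E (f : R[i] -> R[i]) : f \o iter k.+1 al = (f \o iter k al) \o al.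
  by apply/funext => z; rewrite /= -iterSr.
have aK s : period_set L s -> be (al (gamma s)) = gamma s.
  by move=> _; apply: alK; exists s.
have bK s : period_set L s -> al (be (gamma s)) = gamma s.
  by move=> _; apply: beK; exists s.
rewrite !E; split; first exact: (right_invertible_conj bfn cal cbe).
exact: (right_invertible_unconj bfn cal cbe).
Qed.

Let coef_iter k f : cont_on G f -> bounded_coef (L:=L) (gamma:=gamma) (f \o iter k al).
Proof. by move=> cf; apply: (cont_on_coef Jordan); exact: cont_iter. Qed.

Let factor_blo N k w : bounded_linear_op L gamma rho
  (opA (a \o iter k al) (fun z => w * b (iter N al z)) al).
Proof.
apply: (blo_opA bfn cal); first exact: coef_iter.
apply: bounded_coefM; first exact: bounded_coef_cst.
exact: (coef_iter N).
Qed.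

Lemma blo_factors N k ws : bounded_linear_op L gamma rho (factors a b al N k ws).
Proof.
elim: ws k => [|w ws IH] k; first exact: blo_id.
exact: (blo_comp bfn _ _ (factor_blo N k w) (IH k.-1)).
Qed.

Variable m : nat.
Hypothesis m_gt0 : (0 < m)%N.
Hypothesis gauge : forall w : R[i], w ^+ m = 1 -> exists u : R[i] -> R[i],
  [/\ measC_on L gamma u, ae_on L gamma (fun z => nc (u z) = 1)
    & ae_on L gamma (fun z => w * u (al z) = u z)].

(** The factor with shifts k and m-1 is the conjugate by W^k of aI - w (b o alpha_(m-1-k))W; the
    bound on k makes the latter shift meaningful. *)
Lemma right_invertible_factors k ws : rinv (opA a b al) -> (k <= m.-1)%N ->
  {in ws, forall w, w ^+ m = 1} -> rinv (factors a b al m.-1 k ws).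
Proof.
move=> rA; elim: ws k => [|w ws IH] k km Hws.
  by exists id; [exact: blo_id|move=> f _; exact: ae_on_all].
apply: (right_invertible_comp bfn _ _ (factor_blo m.-1 k w) (blo_factors _ _ _)); last first.
  apply: IH; first exact: leq_trans (leq_pred _) km.
  by move=> x xws; apply: Hws; rewrite inE xws orbT.
have [u [mu' nu uw]] := gauge w (Hws _ (mem_head _ _)).
have r1 := right_invertible_gauge bfn _ _ _ _ mu' nu uw
  (right_invertible_iter_shift (m.-1 - k) rA).
have := (right_invertible_iter_conj _ _ k).1 r1.
congr (rinv (opA _ _ _)); apply/funext => z /=.
by rewrite -iterD subnK.
Qed.

Lemma right_invertible_opA_opAm :
  rinv (opA a b al) <-> rinv (opAm m a b al).
Proof.
have [ws Hws E] := XnsubC1_split R m.-1; rewrite prednK// in Hws E.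
rewrite (opAm_factors _ _ _ _ _ _ m_gt0 E); split => [rA|[T bT hT]].
  apply: right_invertible_factors => // w; rewrite inE => /predU1P[->|/Hws//].
  exact: expr1n.
apply/(right_invertible_iter_conj _ _ m.-1).
(* The remaining factors applied after a right inverse of the product form a right inverse of the
   first factor. *)
exists (fun f => factors a b al m.-1 m.-1.-1 ws (T f)).
  exact: (blo_comp bfn _ _ (blo_factors _ _ _) bT).
move=> f /hT; apply: ae_on_imp => s _ /=.
by rewrite /opA /= mul1r.
Qed.

(** If a_i(t) = 0, then a vanishes at alpha_k(t) for some k < i. Nondegeneracy of the pair a, b o
    alpha_(i-1-k) at that point says that b(alpha_(i-1)(t)) is nonzero. *)
Lemma right_invertible_iprod_neq0 : rinv (opA a b al) ->
  forall t, G t -> forall i, (0 < i)%N ->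
  0 < nc (iprod al a i t) + nc (b (iter i.-1 al t)).
Proof.
move=> rA t Gt i i0; rewrite lt0r addr_ge0 ?nc_ge0// andbT.
apply/negP; rewrite paddr_eq0 ?nc_ge0// !nc_eq0 => /andP[/prodf_eq0[k _ /eqP ak] /eqP bi].
have := right_invertible_coef_neq0 _ _ ca (cont_iter (i.-1 - k) _ cb)
  (right_invertible_iter_shift _ rA) _ (iterG k _ Gt).
have ki : (k <= i.-1)%N by rewrite -ltnS prednK.
by rewrite /= -iterD subnK// ak bi nc0 addr0 ltxx.
Qed.

End OneSidedInvertibility.

(** * The multiplicity m and the final equivalence *)

Lemma least_periodP (R : realType) (G : set R[i]) (al : R[i] -> R[i]) :
  has_periodic_point G al ->
  [/\ (0 < least_period G al)%N,
      exists2 t, G t & iter (least_period G al) al t = t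
    & forall j : nat, (0 < j < least_period G al)%N ->
        ~ exists2 t, G t & iter j al t = t].
Proof.
move=> [t Gt [k k0 kt]].
pose P (j : nat) := `[< (0 < j)%N /\ exists2 t, G t & iter j al t = t >].
have exP : exists j, P j by exists k; apply/asboolP; split => //; exists t.
apply: (@xgetPex _ 0%N [set k : nat | [/\ (0 < k)%N,
      (exists2 t, G t & iter k al t = t)
    & forall j : nat, (0 < j < k)%N -> ~ exists2 t, G t & iter j al t = t]]).
case: (ex_minnP exP) => j /asboolP[j0 jt] jmin; exists j; split => // i /andP[i0 ij] it.
by have := jmin i; rewrite leqNgt ij => /(_ _)/negP; apply => //; apply/asboolP.
Qed.

Lemma gauge_exists (R : realType) (L : R) (gamma : R -> R[i]) (al be : R[i] -> R[i]) :
  smooth_jordan_curve L gamma ->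
  C1_on (curve gamma) al -> C1_on (curve gamma) be ->
  (forall t, curve gamma t -> be (al t) = t) ->
  (forall t, curve gamma t -> al (be t) = t) ->
  has_periodic_point (curve gamma) al ->
  (0 < mult gamma al)%N /\ forall w : R[i], w ^+ mult gamma al = 1 ->
    exists u : R[i] -> R[i],
    [/\ measC_on L gamma u,
        ae_on L gamma (fun z => @ComplexField.Normc.normc R (u z) = 1)
      & ae_on L gamma (fun z => w * u (al z) = u z)].
Proof.
move=> J C1al C1be alK beK /least_periodP[k0 [t Gt kt] kmin]; rewrite /mult.
case: asboolP => [[h [ch [ih alh]]]|np]; last first.
  have [h [h1 h2 h3]] := lift_reversing J _ _ C1al C1be alK beK np.
  by split => // w; exact: (gauge_reversing J _ h).
split => // w; case: (least_period _ _) k0 kt kmin => // n _ kt kmin.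
apply: (gauge_preserving J _ _ C1al alK h n t) => //.
by move=> j jn t' Gt' jt'; apply: (kmin j jn); exists t'.
Qed.
Theorem theorem5p7 (R : realType) (L : R) (gamma : R -> R[i])
  (alpha : R[i] -> R[i]) (rho : (R[i] -> R) -> \bar R) (a b : R[i] -> R[i]) :
  smooth_jordan_curve L gamma ->
  diffeo_on (curve gamma) alpha ->
  has_periodic_point (curve gamma) alpha ->
  banach_function_norm L gamma rho ->
  rearrangement_invariant L gamma rho ->
  reflexive_space L gamma rho ->
  fundamental_type L gamma rho ->
  nontrivial_indices L gamma rho ->
  cont_on (curve gamma) a -> cont_on (curve gamma) b ->
  let m := mult gamma alpha in
  right_invertible L gamma rho (opA a b alpha) <->
  (right_invertible L gamma rho (opAm m a b alpha) /\
   forall t, Gamma4 L gamma rho alpha a b t ->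
     forall i : nat, (1 <= i <= m - 1)%N ->
       0 < @ComplexField.Normc.normc R (iprod alpha a i t)
           + @ComplexField.Normc.normc R (b (iter i.-1 alpha t))).
Proof.
move=> J [be [C1al C1be] [alK beK]] per bfn ri _ _ [lo [loup _]] ca cb m.
have boyd_gt0 : 0 < boyd_upper L gamma rho by exact: lt_le_trans loup.
have [m0 gauge] := gauge_exists _ _ _ _ _ J C1al C1be alK beK per.
have E := right_invertible_opA_opAm J _ _ C1al C1be alK beK bfn ri boyd_gt0 _ _ ca cb _ m0 gauge.
split => [rA|[rAm _]]; last exact/E.
split; first exact/E.
move=> t [[Gt _] _] i /andP[i0 _].
exact: (right_invertible_iprod_neq0 J _ _ C1al C1be alK bfn ri boyd_gt0).
Qed.
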